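(* Let $(Y_1,Z_1),\dots,(Y_N,Z_N)$, the functions $\gamma_i$, $h=(h_1,\dots,h_p)$, the domain $D_0$ and the constants $F_1,F_2,a_i,b_i,d_j$ satisfy the Regularity (with $m=1$), Boundedness and Parameter Domain assumptions stated in the context. Fix an arbitrary $\theta\in D_0$. Then for $v\in D_0$, $$\sum_{i=1}^N[\![\gamma_i(h(Z_i)^\top v,Y_i)]\!]=\sum_{i=1}^N[\![\gamma_i(h(Z_i)^\top\theta,Y_i)]\!]+[\xi_1+\xi(v)]\sum_{j=1}^p d_j|v_j-\theta_j|,$$ where $\{\xi(v):v\in D_0\}$ is a process with the upper tail property $$\Pr\Big\{\sup_{v\in D_0}|\xi(v)|>A\sqrt{2\ln(2p)}+B\sqrt{2\ln(p/q)}+C\ln(p/q)\Big\}\le q,\qquad\forall q\in(0,1),$$ and $\xi_1$ is a random variable with the upper tail property $$\Pr\Big\{|\xi_1|>F_1\sqrt{2N\ln(2p/q)}\Big\}\le q,\qquad\forall q\in(0,1).$$ Here $$R=\sup_{u,v\in D_0}\sum_{j=1}^p d_j|u_j-v_j|,\qquad \phi=\min\Big(2F_1,\frac{F_2R}{2}\Big),\qquad\psi=\frac{F_2}{2},$$ $$A=8\psi R\;\mathsf E\sqrt{\max_{j\le p}\sum_{i=1}^N[h_j(Z_i)/d_j]^2},\qquad B=\phi\sqrt{\mathsf E\max_{j\le p}\sum_{i=1}^N[h_j(Z_i)/d_j]^2},\qquad C=8\phi.$$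
   Context: Setting. $(Y_1,Z_1),\dots,(Y_N,Z_N)$ are independent (not necessarily identically distributed) random variables with values in a product measurable space $\mathcal Y\times\mathcal Z$. The $\gamma_i:\mathbb R\times\mathcal Y\to\mathbb R$, $i\le N$, are given functions $\gamma_i(t,y)$; $h=(h_1,\dots,h_p):\mathcal Z\to\mathbb R^p$ is a given function; $D_0\subset\mathbb R^p$ is a nonempty domain (of parameter values). Regularity assumption with $m=1$. There are $-\infty\le a_i<b_i\le\infty$, $i\le N$, such that with probability 1 each $\gamma_i(t,Y_i)$, as a function of $t$, is differentiable on $(a_i,b_i)$ with bounded and Lipschitz derivative. $F_1,F_2$ are constants such that with probability 1, for all $t,t'\in(a_i,b_i)$ and $i\le N$, $|\partial\gamma_i(t,Y_i)/\partial t|\le F_1$ and $|\partial\gamma_i(t,Y_i)/\partial t-\partial\gamma_i(t',Y_i)/\partial t|\le F_2|t-t'|$. Boundedness assumption. There are constants $d_1,\dots,d_p\in(0,\infty)$ with $\Pr\{\max_{i\le N}|h_j(Z_i)|\le d_j\ \forall j\le p\}=1$. Parameter Domain assumption. $\Pr\{h(Z_i)^\top v\in(a_i,b_i)\ \forall v\in D_0,\ i\le N\}=1$. Notation. For a random variable $X$, $[\![X]\!]=X-\mathsf E X$. If $F_2>0$ the result is meaningful only when $R<\infty$, that is, when $D_0$ is bounded; if $F_2=0$, then $A=B=C=0$.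
   Formalization: ξ_1 is allowed to depend on v, with its tail bound proved for sup over v∈D_0 of |ξ_1(v)|; a single v-independent ξ_1 is impossible in general (γ(t,y)=ty, Y=±1, h=1, F_2=0, D_0=[-1,1], θ=0). *)

(* Defs.v *)
From HB Require Import structures.
From mathcomp Require Import all_boot all_order all_algebra.
From mathcomp Require Import all_classical all_reals all_analysis.
From mathcomp Require Import measurable_realfun.

Set Implicit Arguments.
Unset Strict Implicit.
Unset Printing Implicit Defensive.

Import Order.TTheory GRing.Theory Num.Theory.
Import numFieldNormedType.Exports.

Local Open Scope classical_set_scope.
Local Open Scope ring_scope.

Definition mutually_independent (d d' : measure_display)
    (Omega : measurableType d) (T : measurableType d') (R : realType)
    (P : probability Omega R) (I : finType) (X : I -> Omega -> T) : Prop :=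
  forall (J : {set I}) (A : I -> set T),
    (forall i, measurable (A i)) ->
    (P (\bigcap_(i in [set` J]) X i @^-1` A i) =
     \prod_(i in J) P (X i @^-1` A i))%E.

(* The bracket [[X]] = X - E X; only meaningful for integrable X, since [fine]
   sends an infinite expectation to 0. *)
Definition centered (d : measure_display) (Omega : measurableType d)
    (R : realType) (P : probability Omega R) (X : Omega -> R) : Omega -> R :=
  fun w => X w - fine 'E_P[X]%E.

Definition dotp (R : realType) (p : nat) (x v : 'rV[R]_p) : R :=
  \sum_(j < p) x 0 j * v 0 j.

Definition wdist (R : realType) (p : nat) (dd : 'I_p -> R) (u v : 'rV[R]_p) : R :=
  \sum_(j < p) dd j * `|u 0 j - v 0 j|.

Definition inside (R : realType) (a b : \bar R) (t : R) : Prop :=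
  (a < t%:E)%E /\ (t%:E < b)%E.

(* "With probability 1" is rendered by almost-everywhere quantification, i.e.
   validity on some measurable event of probability 1: the events below involve
   uncountably many parameters and need not be measurable themselves.
   Boundedness and the Lipschitz property of the derivative are carried by the
   two inequalities with the constants F1 and F2. *)
Definition regularity (d dY : measure_display) (Omega : measurableType d)
    (TY : measurableType dY) (R : realType) (P : probability Omega R) (N : nat)
    (Y : 'I_N -> Omega -> TY) (gamma : 'I_N -> R -> TY -> R)
    (a b : 'I_N -> \bar R) (F1 F2 : R) : Prop :=
  (forall i, a i < b i)%E /\
  {ae P, forall w, forall i : 'I_N,
    let g := fun t : R => gamma i t (Y i w) in
    [/\ forall t, inside (a i) (b i) t -> derivable g t 1,
        forall t, inside (a i) (b i) t -> `|derive1 g t| <= F1 &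
        forall t t', inside (a i) (b i) t -> inside (a i) (b i) t' ->
          `|derive1 g t - derive1 g t'| <= F2 * `|t - t'|]}.

Definition boundedness (d dZ : measure_display) (Omega : measurableType d)
    (TZ : measurableType dZ) (R : realType) (P : probability Omega R)
    (N p : nat) (Z : 'I_N -> Omega -> TZ) (h : TZ -> 'rV[R]_p)
    (dd : 'I_p -> R) : Prop :=
  (forall j, 0 < dd j) /\
  {ae P, forall w, forall (j : 'I_p) (i : 'I_N), `|h (Z i w) 0 j| <= dd j}.

Definition parameter_domain (d dZ : measure_display) (Omega : measurableType d)
    (TZ : measurableType dZ) (R : realType) (P : probability Omega R)
    (N p : nat) (Z : 'I_N -> Omega -> TZ) (h : TZ -> 'rV[R]_p)
    (D0 : set 'rV[R]_p) (a b : 'I_N -> \bar R) : Prop :=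
  {ae P, forall w, forall (v : 'rV[R]_p) (i : 'I_N), D0 v ->
    inside (a i) (b i) (dotp (h (Z i w)) v)}.

(* R, phi and A are extended reals, so that an unbounded D0 is allowed.
   Since 0 * +oo = 0 in \bar R, F2 = 0 gives phi = A = B = C = 0 even when the
   diameter is infinite. *)
Definition diam (R : realType) (p : nat) (dd : 'I_p -> R)
    (D0 : set 'rV[R]_p) : \bar R :=
  ereal_sup [set (wdist dd u v)%:E | u in D0 & v in D0].

Definition phi_const (R : realType) (F1 F2 : R) (diamR : \bar R) : \bar R :=
  Order.min (2 * F1)%:E (F2%:E * diamR * (2^-1)%:E)%E.

Definition psi_const (R : realType) (F2 : R) : R := F2 / 2.

(* The default value 0 of the iterated maximum is harmless: the terms are
   nonnegative. *)
Definition max_sumsq (d dZ : measure_display) (Omega : measurableType d)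
    (TZ : measurableType dZ) (R : realType) (N p : nat)
    (Z : 'I_N -> Omega -> TZ) (h : TZ -> 'rV[R]_p) (dd : 'I_p -> R)
    (w : Omega) : R :=
  \big[Order.max/0]_(j < p) \sum_(i < N) (h (Z i w) 0 j / dd j) ^+ 2.

Definition A_const (d dZ : measure_display) (Omega : measurableType d)
    (TZ : measurableType dZ) (R : realType) (P : probability Omega R)
    (N p : nat) (Z : 'I_N -> Omega -> TZ) (h : TZ -> 'rV[R]_p)
    (dd : 'I_p -> R) (F2 : R) (diamR : \bar R) : \bar R :=
  ((8 * psi_const F2)%:E * diamR *
    'E_P[fun w => Num.sqrt (max_sumsq Z h dd w)])%E.

Definition B_const (d dZ : measure_display) (Omega : measurableType d)
    (TZ : measurableType dZ) (R : realType) (P : probability Omega R)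
    (N p : nat) (Z : 'I_N -> Omega -> TZ) (h : TZ -> 'rV[R]_p)
    (dd : 'I_p -> R) (F1 F2 : R) (diamR : \bar R) : \bar R :=
  (phi_const F1 F2 diamR * sqrte 'E_P[max_sumsq Z h dd])%E.

Definition C_const (R : realType) (F1 F2 : R) (diamR : \bar R) : \bar R :=
  (8%:E * phi_const F1 F2 diamR)%E.

Definition sup_abs (Omega : Type) (R : realType) (V : Type) (D0 : set V)
    (xi : V -> Omega -> R) (w : Omega) : \bar R :=
  ereal_sup [set `|xi v w|%:E | v in D0].

(* Main.v *)
Require Import Defs.
From HB Require Import structures.
From mathcomp Require Import all_boot all_order all_algebra.
From mathcomp Require Import all_classical all_reals all_analysis.
From mathcomp Require Import measurable_realfun.
From mathcomp Require Import ring lra.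

(** Write t = h(Z_i)^T (v - theta). The increment of gamma_i between h(Z_i)^T theta
    and h(Z_i)^T v is t * (gamma_i' + g_i), where gamma_i' is the derivative at
    h(Z_i)^T theta and the slope remainder g_i satisfies
    |g_i| <= min (2 F1, F2 |t| / 2) and is F2 / 2-Lipschitz in t. Expanding the
    factor t along the coordinates and centring gives, almost surely for all v,

      S v - S theta = \sum_j d_j (v_j - theta_j) (T_j + W_j v),

    where T_j is the centred sum of the h_j(Z_i) / d_j * gamma_i' and W_j v that of
    the h_j(Z_i) / d_j * g_i. The variables xi1 and xi are the two parts of the
    right-hand side divided by \sum_j d_j |v_j - theta_j|; they are at most
    max_j |T_j| and max_j |W_j v| in absolute value ([linearization]).

    The bound on xi1 is Hoeffding's inequality for the 2p sums +T_j and -T_j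
    ([hoeffding_tail]).

    For xi it is enough to bound max_k |W_j v_k| for finitely many v_k: almost surely
    the numerator of xi is Lipschitz in v, so the supremum over the domain is a
    supremum over a sequence, that is, a limit of finite maxima
    ([ereal_sup_ratio_dense], [tail_ereal_sup_seq]). Two facts are combined.

    - Concentration. All summands of W_j v_k are bounded by phi * |h_j(Z_i) / d_j|,
      which is free of k. Revealing the observations one after the other, the
      increments of the Doob martingale of max_k |W_j v_k| are bounded by this
      envelope and its mean, and their variances by its mean square. Bernstein's
      argument then gives the terms with B and C ([mgf_max_deviation],
      [bernstein_tail]).

    - Expectation. Random signs replace the centring ([symmetrization]), contraction
      replaces each summand by F2 / 2 times the linear form h(Z_i)^T (v_k - theta)
      ([rademacher_contraction]), and a signed sum of these forms is at most the
      radius of the set times the maximum over the p coordinates of the signed sums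
      of the h_j(Z_i) / d_j ([rademacher_max]). This gives the term with A
      ([expect_max_deviation]).

    Conditioning on part of the observations is expressed by integrating over a second
    copy of the sample point ([expect_decouple]). *)

Set Implicit Arguments.
Unset Strict Implicit.
Unset Printing Implicit Defensive.

Import Order.TTheory GRing.Theory Num.Theory.
Import numFieldNormedType.Exports.

Local Open Scope classical_set_scope.
Local Open Scope ring_scope.

(** * Exponential inequalities *)

Lemma derive_ge0_from0 (R : realType) (f df : R -> R) :
  (forall x : R, is_derive x 1 f (df x)) -> (forall x, 0 <= x -> 0 <= df x) ->
  forall x, 0 <= x -> f 0 <= f x.
Proof.
move=> fdf df0 x x0.
have [|c] := @MVT_segment R f df 0 x x0 (fun y _ => fdf y).
  by apply: derivable_within_continuous => z _; have [] := fdf z.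
rewrite in_itv/= => /andP[c0 cx] fE.
by rewrite -subr_ge0 fE mulr_ge0 ?df0 ?subr0.
Qed.

Lemma is_derive_expRN (R : realType) (x : R) :
  is_derive x 1 (fun y => expR (- y)) (- expR (- x)).
Proof.
have H : is_derive x 1 (expR \o -%R) (expR (- x) * -1).
  exact: is_derive1_comp.
by rewrite mulrN1 in H.
Qed.

Lemma expR_le_deg2 (R : realType) (x : R) : 0 <= x ->
  expR (- x) <= 1 - x + x ^+ 2 / 2.
Proof.
move=> x0.
pose f (y : R) := 1 - y + y ^+ 2 / 2 - expR (- y).
suff : f 0 <= f x.
  by rewrite /f oppr0 expR0 expr0n/=; lra.
apply: (@derive_ge0_from0 _ f (fun y => -1 + y + expR (- y))) => // y.
- have ? := is_derive_expRN y.
  rewrite /f; apply: is_derive_eq.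
  by rewrite /GRing.scale/=; lra.
- by move=> y0; have := expR_ge1Dx (- y); lra.
Qed.

(** The quadratic coefficient 1/2 makes the Gaussian part of the Bernstein tail
    sharp; the singularity at |x| = 1 only enters its linear part. *)
Lemma expR_bernstein (R : realType) (x : R) : `|x| < 1 ->
  expR x <= 1 + x + x ^+ 2 / 2 / (1 - `|x|).
Proof.
have [x0|x0] := leP 0 x.
  rewrite ger0_norm // => x1.
  pose f (y : R) := 2 - y ^+ 2 - 2 * ((1 - y) * expR y).
  have : f 0 <= f x.
    apply: (@derive_ge0_from0 _ f (fun y => 2 * y * (expR y - 1))) => // y.
    - rewrite /f; apply: is_derive_eq.
      by rewrite /GRing.scale/=; lra.
    - by move=> y0; rewrite mulr_ge0 ?mulr_ge0 // subr_ge0 -expR0 ler_expR.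
  rewrite /f expR0 expr0n/= !subr0 !mulr1 subrr => fx.
  rewrite -lerBlDl ler_pdivlMr ?subr_gt0 //.
  by move: fx; lra.
rewrite ltr0_norm // opprK => x1.
have := @expR_le_deg2 R (- x); rewrite opprK sqrrN => /(_ _)/le_trans; apply.
  by lra.
rewrite lerD2l ler_pdivlMr; last lra.
have : 0 <= x ^+ 2 / 2 by rewrite divr_ge0 ?sqr_ge0.
by nra.
Qed.

(** The left-hand side is D(t) = E exp(t X) for X in {-1, 1} of mean mu. The
    logarithmic derivative u = D' / D satisfies u(0) = mu and u' = 1 - u^2 <= 1,
    so ln D(t) <= mu t + t^2 / 2; the function k below is mu + t - u(t). *)
Lemma hoeffding_two_point_ge0 (R : realType) (mu t : R) :
  -1 <= mu <= 1 -> 0 <= t ->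
  (1 + mu) / 2 * expR t + (1 - mu) / 2 * expR (- t) <=
  expR (mu * t + t ^+ 2 / 2).
Proof.
move=> /andP[mu1 mu2] t0.
pose a := (1 + mu) / 2; pose b := (1 - mu) / 2.
have a0 : 0 <= a by rewrite /a; lra.
have b0 : 0 <= b by rewrite /b; lra.
have ab : a + b = 1 by rewrite /a /b; lra.
have abmu : a - b = mu by rewrite /a /b; lra.
pose D y := a * expR y + b * expR (- y).
pose D' y := a * expR y - b * expR (- y).
have D0 y : 0 < D y.
  have e1 := expR_gt0 y; have e2 := expR_gt0 (- y).
  have [a1|a1] := ltP 0 a.
    by apply: ltr_pwDl; [exact: mulr_gt0 | apply: mulr_ge0 => //; exact: ltW].
  have a_eq0 : a = 0 by lra.
  by rewrite /D a_eq0 mul0r add0r mulr_gt0 //; lra.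
have dD (y : R) : is_derive y 1 D (D' y).
  have ? := is_derive_expRN y.
  rewrite /D; apply: is_derive_eq.
  by rewrite /D' /GRing.scale/=; lra.
have dD' (y : R) : is_derive y 1 D' (D y).
  have ? := is_derive_expRN y.
  rewrite /D'; apply: is_derive_eq.
  by rewrite /D /GRing.scale/=; lra.
have Dinv (y : R) : is_derive y 1 (fun z => (D z)^-1) (- (D y) ^- 2 *: D' y).
  by apply: is_deriveV; rewrite gt_eqF.
pose k y := mu + y - D' y * (D y)^-1.
have k_ge0 y : 0 <= y -> 0 <= k y.
  move=> y0; have <- : k 0 = 0.
    by rewrite /k /D /D' oppr0 expR0 !mulr1 ab invr1 abmu; lra.
  move: y y0; apply: (@derive_ge0_from0 _ k (fun y => (D' y / D y) ^+ 2)) => [z|z _].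
    rewrite /k; apply: is_derive_eq.
    rewrite /GRing.scale/=.
    by have := D0 z; move=> /lt0r_neq0 ?; field.
  exact: sqr_ge0.
pose f y := mu * y + y ^+ 2 / 2 - ln (D y).
have : f 0 <= f t.
  apply: (@derive_ge0_from0 _ f k) => // y.
  have dln : is_derive y 1 ((@ln R) \o D) ((D y)^-1 * D' y).
    have ? := is_derive1_ln (D0 y).
    exact: is_derive1_comp.
  have {}dln : is_derive y 1 (fun y => ln (D y)) ((D y)^-1 * D' y) by exact: dln.
  rewrite /f; apply: is_derive_eq.
  by rewrite /k /GRing.scale/=; lra.
rewrite /f {1}/D oppr0 expR0 !mulr1 ab ln1 subr0 mulr0 expr0n/= mul0r addr0.
rewrite subr_ge0 => H.
by rewrite -/(D t) -[leLHS]lnK ?ler_expR // posrE.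
Qed.

(** The case t < 0 exchanges the two points, which changes the sign of mu. *)
Lemma hoeffding_two_point (R : realType) (mu t : R) :
  -1 <= mu <= 1 ->
  (1 + mu) / 2 * expR t + (1 - mu) / 2 * expR (- t) <=
  expR (mu * t + t ^+ 2 / 2).
Proof.
move=> mu1; have [t0|t0] := leP 0 t; first exact: hoeffding_two_point_ge0.
have := @hoeffding_two_point_ge0 R (- mu) (- t).
rewrite !opprK sqrrN mulrNN addrC; apply; last by rewrite oppr_ge0 ltW.
by move: mu1 => /andP[? ?]; apply/andP; split; lra.
Qed.

Lemma expR_convex_chord (R : realType) (x t : R) : -1 <= x <= 1 ->
  expR (t * x) <= (1 + x) / 2 * expR t + (1 - x) / 2 * expR (- t).
Proof.
move=> /andP[x1 x2].
(* sum of the two tangent inequalities at t * x, with weights (1 +- x) / 2 *)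
have H y : expR (t * x) * (1 + (y - t * x)) <= expR y.
  rewrite -{2}(subrK (t * x) y) expRD mulrC ler_wpM2r ?expR_ge0 //.
  exact: expR_ge1Dx.
have H1 : (1 + x) / 2 * (expR (t * x) * (1 + (t - t * x))) <= (1 + x) / 2 * expR t.
  by rewrite ler_wpM2l //; lra.
have H2 : (1 - x) / 2 * (expR (t * x) * (1 + (- t - t * x))) <= (1 - x) / 2 * expR (- t).
  by rewrite ler_wpM2l //; lra.
apply: le_trans (lerD H1 H2).
by rewrite le_eqVlt; apply/orP; left; apply/eqP; field.
Qed.

Lemma expR_average_sign (R : realType) (t : R) :
  (expR t + expR (- t)) / 2 <= expR (t ^+ 2 / 2).
Proof.
have := @hoeffding_two_point R 0 t.
rewrite addr0 subr0 mul0r add0r mul1r => /(_ _)/(le_trans _); apply; lra.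
Qed.

(** * Bounded measurable functions and their expectations *)

(** Boundedness is carried along with measurability: under a probability it makes
    every expectation below finite. *)
Definition bmeas d (T : measurableType d) (R : realType) (f : T -> R) : Prop :=
  measurable_fun setT f /\ exists M, forall x, `|f x| <= M.

Section bounded_measurable.
Context d (T : measurableType d) (R : realType).
Implicit Types f g : T -> R.

Lemma bmeas_cst (c : R) : bmeas (fun _ : T => c).
Proof. by split; [exact: measurable_cst | exists `|c|]. Qed.

Lemma bmeasD f g : bmeas f -> bmeas g -> bmeas (fun x => f x + g x).
Proof.
move=> [mf [M fM]] [mg [K gK]]; split; first exact: measurable_funD.
by exists (M + K) => x; rewrite (le_trans (ler_normD _ _)) // lerD.
Qed.

Lemma bmeasM f g : bmeas f -> bmeas g -> bmeas (fun x => f x * g x).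
Proof.
move=> [mf [M fM]] [mg [K gK]]; split; first exact: measurable_funM.
by exists (M * K) => x; rewrite normrM ler_pM.
Qed.

Lemma bmeasZ (c : R) f : bmeas f -> bmeas (fun x => c * f x).
Proof. by move=> bf; apply: bmeasM => //; exact: bmeas_cst. Qed.

Lemma bmeasN f : bmeas f -> bmeas (fun x => - f x).
Proof.
move=> [mf [M fM]]; split; first exact: measurableT_comp.
by exists M => x; rewrite normrN.
Qed.

Lemma bmeasB f g : bmeas f -> bmeas g -> bmeas (fun x => f x - g x).
Proof. by move=> bf /bmeasN; exact: bmeasD. Qed.

Lemma bmeas_norm f : bmeas f -> bmeas (fun x => `|f x|).
Proof.
move=> [mf [M fM]]; split; first exact: measurableT_comp.
by exists M => x; rewrite normr_id.
Qed.

Lemma bmeas_max f g : bmeas f -> bmeas g -> bmeas (fun x => Num.max (f x) (g x)).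
Proof.
move=> [mf [M fM]] [mg [K gK]]; split; first exact: measurable_maxr.
exists (Num.max M K) => x; rewrite le_max; case: (leP (f x) (g x)) => _.
  by rewrite gK orbT.
by rewrite fM.
Qed.

Lemma bmeas_sum (I : Type) (s : seq I) (Q : pred I) (f : I -> T -> R) :
  (forall i, bmeas (f i)) -> bmeas (fun x => \sum_(i <- s | Q i) f i x).
Proof.
move=> bf; elim: s => [|i s IH].
  by under eq_fun do rewrite big_nil; exact: bmeas_cst.
case Qi: (Q i); last by under eq_fun do rewrite big_cons Qi.
by under eq_fun do rewrite big_cons Qi; exact: bmeasD.
Qed.

Lemma bmeas_bigmax (I : Type) (s : seq I) (f : I -> T -> R) :
  (forall i, bmeas (f i)) -> bmeas (fun x => \big[Order.max/0]_(i <- s) f i x).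
Proof.
move=> bf; elim: s => [|i s IH].
  by under eq_fun do rewrite big_nil; exact: bmeas_cst.
under eq_fun do rewrite big_cons.
exact: bmeas_max.
Qed.

Lemma bmeas_expR f : bmeas f -> bmeas (fun x => expR (f x)).
Proof.
move=> [mf [M fM]]; split; first exact: measurableT_comp.
exists (expR M) => x; rewrite ger0_norm ?expR_ge0 // ler_expR.
exact: le_trans (ler_norm _) (fM x).
Qed.

Lemma bmeas_comp d' (T' : measurableType d') (f : T -> R) (h : T' -> T) :
  bmeas f -> measurable_fun setT h -> bmeas (f \o h).
Proof.
move=> [mf [M fM]] mh; split; first exact: measurableT_comp.
by exists M => x; exact: fM.
Qed.

Section expectation.
Variable P : probability T R.

Lemma bmeas_integrable f : bmeas f -> P.-integrable setT (EFin \o f).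
Proof.
move=> [mf [M fM]]; apply: measurable_bounded_integrable => //.
  by rewrite (le_lt_trans (probability_le1 P _)) // ltey.
exists M; split; first exact: num_real.
by move=> x Mx y _; exact: le_trans (fM y) (ltW Mx).
Qed.

Lemma expect_cst (c : R) : \int[P]_x c = c.
Proof. by rewrite Rintegral_cst // [X in fine X](probability_setT P) mulr1. Qed.

Lemma expectD f g : bmeas f -> bmeas g ->
  \int[P]_x (f x + g x) = \int[P]_x f x + \int[P]_x g x.
Proof. by move=> bf bg; rewrite RintegralD //; exact: bmeas_integrable. Qed.

Lemma expectB f g : bmeas f -> bmeas g ->
  \int[P]_x (f x - g x) = \int[P]_x f x - \int[P]_x g x.
Proof. by move=> bf bg; rewrite RintegralB //; exact: bmeas_integrable. Qed.

Lemma expectZ (c : R) f : bmeas f -> \int[P]_x (c * f x) = c * \int[P]_x f x.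
Proof. by move=> bf; rewrite RintegralZl //; exact: bmeas_integrable. Qed.

Lemma expectN f : bmeas f -> \int[P]_x (- f x) = - \int[P]_x f x.
Proof.
move=> bf; rewrite -mulN1r -expectZ //.
by congr Rintegral; apply/funext => x; rewrite mulN1r.
Qed.

Lemma expect_sum (I : Type) (s : seq I) (Q : pred I) (f : I -> T -> R) :
  (forall i, bmeas (f i)) ->
  \int[P]_x (\sum_(i <- s | Q i) f i x) = \sum_(i <- s | Q i) \int[P]_x f i x.
Proof.
move=> bf; elim: s => [|i s IH].
  rewrite big_nil -[RHS](expect_cst 0).
  by congr Rintegral; apply/funext => x; rewrite big_nil.
rewrite big_cons -IH; case: ifP => Qi.
  rewrite -expectD //; last exact: bmeas_sum.
  by congr Rintegral; apply/funext => x; rewrite big_cons Qi.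
by congr Rintegral; apply/funext => x; rewrite big_cons Qi.
Qed.

Lemma expect_le_ae f g : bmeas f -> bmeas g ->
  {ae P, forall x, f x <= g x} -> \int[P]_x f x <= \int[P]_x g x.
Proof.
move=> bf bg fg; rewrite -subr_ge0 -expectB //.
have -> : \int[P]_x (g x - f x) = \int[P]_x `|g x - f x|.
  congr fine; apply: ae_eq_integral => //.
  - by apply/measurable_EFinP; have [] := bmeasB bg bf.
  - by apply/measurable_EFinP; have [] := bmeas_norm (bmeasB bg bf).
  - by apply: filterS fg => x fgx _; rewrite ger0_norm // subr_ge0.
exact: Rintegral_ge0.
Qed.

Lemma expect_le f g : bmeas f -> bmeas g ->
  (forall x, f x <= g x) -> \int[P]_x f x <= \int[P]_x g x.
Proof. by move=> bf bg fg; apply: expect_le_ae => //; exact: aeW. Qed.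

Lemma expect_norm_le f : bmeas f -> `|\int[P]_x f x| <= \int[P]_x `|f x|.
Proof. by move=> bf; exact: (le_normr_Rintegral measurableT (bmeas_integrable bf)). Qed.

Lemma EFin_expect f : bmeas f ->
  (\int[P]_x f x)%:E = (\int[P]_x (f x)%:E)%E.
Proof.
move=> bf; rewrite fineK //; apply: integrable_fin_num => //.
exact: bmeas_integrable.
Qed.

End expectation.
End bounded_measurable.

Section partial_expectation.
Context d1 d2 (T1 : measurableType d1) (T2 : measurableType d2) (R : realType).
Variables (P : probability T2 R) (F : T1 * T2 -> R).
Hypotheses (bF : bmeas F) (F0 : forall x, 0 <= F x).

Lemma bmeas_pair1 x : bmeas (fun y => F (x, y)).
Proof. exact: (bmeas_comp bF (measurable_pair1 x)). Qed.

Lemma bmeas_partial_expectation : bmeas (fun x => \int[P]_y F (x, y)).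
Proof.
split.
  apply: (measurableT_comp (fine_measurable measurableT)).
  apply: (@measurable_fun_fubini_tonelli_F _ _ _ _ _ P (EFin \o F)).
    by apply/measurable_EFinP; have [] := bF.
  by move=> x; rewrite lee_fin.
have [_ [M FM]] := bF; exists M => x.
rewrite (le_trans (expect_norm_le P (bmeas_pair1 x))) //.
rewrite -[leRHS](expect_cst P); apply: expect_le => [||y]; last exact: FM.
  exact: bmeas_norm (bmeas_pair1 x).
exact: bmeas_cst.
Qed.

End partial_expectation.

(** * Decoupling of independent sub-sigma-algebras *)

Section decoupling.
Context d (Omega : measurableType d) (R : realType) (P : probability Omega R).
Implicit Types G H : set (set Omega).

(** Both sides are finite measures of A that agree on a generating pi-system. *)
Lemma independent_g_sigma_algebra G (B : set Omega) :
  G `<=` measurable -> setI_closed G -> G setT -> measurable B ->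
  (forall A, G A -> P (A `&` B) = P A * P B)%E ->
  forall A, <<s G >> A -> (P (A `&` B) = P A * P B)%E.
Proof.
move=> mG IG GT mB GB A sA.
have finB : P B \is a fin_num by exact: fin_num_measure.
have pB0 : 0 <= fine (P B) by exact: fine_ge0.
pose m1 := mrestr P mB.
pose m2 := mscale (NngNum pB0) P.
have m2E C : (m2 C = P C * P B)%E.
  transitivity ((fine (P B))%:E * P C)%E; first by [].
  by rewrite fineK // muleC.
rewrite -m2E -[LHS]/(m1 A).
apply: (@g_sigma_algebra_measure_unique _ _ _ G mG (fun=> setT)) => //.
- by apply/seteqP; split => // x _; exists 0%N.
- by move=> C GC; exact: etrans (GB C GC) (esym (m2E C)).
- move=> k; apply: (@le_lt_trans _ _ (P (setT `&` B))); first exact: le_refl.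
  by rewrite setTI ltey_eq finB.
Qed.

Section two_algebras.
Variables G H : set (set Omega).
Hypotheses (mG : G `<=` measurable) (IG : setI_closed G) (GT : G setT).
Hypotheses (mH : H `<=` measurable) (IH : setI_closed H) (HT : H setT).
Hypothesis GH : forall A B, G A -> H B -> (P (A `&` B) = P A * P B)%E.

Lemma independent_g_sigma_algebras A B : <<s G >> A -> <<s H >> B ->
  (P (A `&` B) = P A * P B)%E.
Proof.
move=> sA sB.
have mA : measurable A.
  exact: (smallest_sub (@sigma_algebra_measurable _ Omega) mG sA).
rewrite setIC muleC; apply: (independent_g_sigma_algebra mH) => // C HC.
rewrite setIC muleC; apply: (independent_g_sigma_algebra mG) => //.
  exact: mH.
by move=> D GD; exact: GH.
Qed.

Let OmG := g_sigma_algebraType G.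
Let OmH := g_sigma_algebraType H.

Let measurable_toG : measurable_fun setT (id : Omega -> OmG).
Proof.
move=> _ A mA; rewrite setTI.
exact: (smallest_sub (@sigma_algebra_measurable _ Omega) mG mA).
Qed.

Let measurable_toH : measurable_fun setT (id : Omega -> OmH).
Proof.
move=> _ A mA; rewrite setTI.
exact: (smallest_sub (@sigma_algebra_measurable _ Omega) mH mA).
Qed.

(** The law of (w, w) on the product of the two sub-sigma-algebras is a product
    measure, so conditioning on one of them is an integral over a second copy of
    the sample point. *)
Lemma expect_decouple (F : OmG * OmH -> R) : bmeas F -> (forall x, 0 <= F x) ->
  \int[P]_w F (w, w) = \int[P]_w \int[P]_w' F (w, w').
Proof.
move=> bF F0.
have mF : measurable_fun setT (EFin \o F) by apply/measurable_EFinP; case: bF.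
have F0' x : (0 <= (EFin \o F) x)%E by rewrite lee_fin.
pose toG : {mfun Omega >-> OmG} := HB.pack (id : Omega -> OmG)
  (isMeasurableFun.Build _ _ _ _ _ measurable_toG).
pose toH : {mfun Omega >-> OmH} := HB.pack (id : Omega -> OmH)
  (isMeasurableFun.Build _ _ _ _ _ measurable_toH).
have mGH : measurable_fun setT (fun w : Omega => @pair OmG OmH w w).
  exact: (measurable_fun_pair measurable_toG measurable_toH).
pose toGH : {mfun Omega >-> (OmG * OmH)%type} :=
  HB.pack (fun w : Omega => @pair OmG OmH w w)
  (isMeasurableFun.Build _ _ _ _ _ mGH).
pose PG := distribution P toG; pose PH := distribution P toH.
have bF1 (w : OmG) : bmeas (fun w' : Omega => F (w, w')).
  exact: (bmeas_comp (bmeas_pair1 bF w) measurable_toH).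
rewrite /Rintegral; congr fine.
have -> : (\int[P]_w (F (w, w))%:E =
    \int[distribution P toGH]_x (EFin \o F) x)%E.
  by rewrite ge0_integral_distribution.
transitivity (\int[(PG \x PH)%E]_x (EFin \o F) x)%E.
  apply: eq_measure_integral => A mA _; apply/esym.
  apply: product_measure_unique => // B C mB mC.
  exact: independent_g_sigma_algebras.
rewrite fubini_tonelli1 //=.
transitivity (\int[PG]_w \int[P]_w' (F (w, w'))%:E)%E.
  apply: eq_integral => w _; rewrite /fubini_F.
  apply: (@ge0_integral_distribution _ _ _ _ _ P toH (fun y => (F (w, y))%:E)).
    exact: (measurableT_comp mF (measurable_pair1 w)).
  by move=> y; rewrite lee_fin.
pose J := fun w : OmG => (\int[P]_w' (F (w, w'))%:E)%E.
transitivity (\int[P]_w (J \o toG) w)%E.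
  apply: ge0_integral_distribution; last first.
    by move=> w; apply: integral_ge0 => w' _; rewrite lee_fin.
  have [mI _] : bmeas (fun w : OmG => \int[P]_w' F (w, w')).
    pose h := fun x : OmG * Omega => @pair OmG OmH x.1 x.2.
    have mh : measurable_fun setT h.
      apply: measurable_fun_pair; first exact: measurable_fst.
      exact: (measurableT_comp measurable_toH measurable_snd).
    exact: (bmeas_partial_expectation P (bmeas_comp bF mh) (fun x => F0 (h x))).
  apply: (eq_measurable_fun (EFin \o (fun w : OmG => \int[P]_w' F (w, w')))).
    by move=> w _; rewrite /J -EFin_expect.
  exact/measurable_EFinP.
by apply: eq_integral => w _; rewrite /J /= -EFin_expect.
Qed.

End two_algebras.
End decoupling.

(** * Independent families *)

Section independent_family.
Context d dT (Omega : measurableType d) (T : measurableType dT) (R : realType)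
  (P : probability Omega R) (I : finType) (U : I -> Omega -> T).
Hypothesis mU : forall i, measurable_fun setT (U i).
Hypothesis indepU : mutually_independent P U.

(** A pi-system that generates the sigma-algebra of the U i with i in J. *)
Definition cylinders (J : {set I}) : set (set Omega) :=
  [set B | exists2 A : I -> set T, (forall i, measurable (A i)) &
    B = \bigcap_(i in [set` J]) U i @^-1` A i].

Lemma measurable_cylinders J : cylinders J `<=` measurable.
Proof.
move=> _ [A mA ->]; apply: fin_bigcap_measurable => // i _.
by rewrite -[_ @^-1` _]setTI; exact: mU.
Qed.

Lemma setI_closed_cylinders J : setI_closed (cylinders J).
Proof.
move=> _ _ [A mA ->] [B mB ->]; exists (fun i => A i `&` B i).
  by move=> i; exact: measurableI.
by rewrite -bigcapI; apply: eq_bigcapr => i _; rewrite preimage_setI.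
Qed.

Lemma setT_cylinders J : cylinders J setT.
Proof.
exists (fun=> setT) => //; apply/esym.
by apply: bigcapT => i _; rewrite preimage_setT.
Qed.

(** The product rule is applied to a single family of sets, equal to A on J and
    to B on K. *)
Lemma independent_cylinders (J K : {set I}) : (forall i, i \in J -> i \notin K) ->
  forall A B, cylinders J A -> cylinders K B ->
  (P (A `&` B) = P A * P B)%E.
Proof.
move=> JK _ _ [A mA ->] [B mB ->].
pose C i := if i \in J then A i else B i.
have mC i : measurable (C i) by rewrite /C; case: ifP.
have CA i : i \in J -> C i = A i by rewrite /C => ->.
have CB i : i \in K -> C i = B i.
  by move=> iK; rewrite /C; case: ifP => // /JK; rewrite iK.
have -> : \bigcap_(i in [set` J]) U i @^-1` A i `&`
          \bigcap_(i in [set` K]) U i @^-1` B i =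
          \bigcap_(i in [set` J :|: K]) U i @^-1` C i.
  apply/seteqP; split => [w [wA wB] i /=|w wC].
    rewrite inE => /orP[iJ|iK]; first by rewrite CA //; apply: wA.
    by rewrite CB //; exact: wB.
  split => i /= iJK; first by rewrite -CA //; apply: wC; rewrite /= inE iJK.
  by rewrite -CB //; apply: wC; rewrite /= inE iJK orbT.
rewrite !indepU // (eq_bigl [predU J & K]); last by move=> i; rewrite inE.
rewrite bigU /=; last first.
  by apply/pred0P => i /=; apply/negbTE; rewrite negb_and -implybE; apply/implyP/JK.
congr (_ * _)%E.
  by apply: eq_bigr => i iJ; rewrite CA.
by apply: eq_bigr => i iK; rewrite CB.
Qed.

Definition sigma_of (J : {set I}) := g_sigma_algebraType (cylinders J).

Lemma measurable_sigma_of (J : {set I}) i : i \in J ->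
  measurable_fun setT (U i : sigma_of J -> T).
Proof.
move=> iJ _ B mB; rewrite setTI; apply: sub_sigma_algebra.
exists (fun j => if j == i then B else setT); first by move=> j; case: ifP.
apply/seteqP; split => [w wB j jJ|w /(_ i iJ)]; last by rewrite /= eqxx.
by rewrite /=; case: eqP => // ->.
Qed.

Lemma expect_decouple_family (J K : {set I}) (F : sigma_of J * sigma_of K -> R) :
  (forall i, i \in J -> i \notin K) -> bmeas F -> (forall x, 0 <= F x) ->
  \int[P]_w F (w, w) = \int[P]_w \int[P]_w' F (w, w').
Proof.
move=> JK bF F0.
exact: (expect_decouple (@measurable_cylinders J) (@setI_closed_cylinders J)
  (setT_cylinders J) (@measurable_cylinders K) (@setI_closed_cylinders K)
  (setT_cylinders K) (independent_cylinders JK)).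
Qed.

End independent_family.

(** * Bernstein's moment bound *)

Section bernstein_mgf.
Context d (Omega : measurableType d) (R : realType) (P : probability Omega R).

(** The mean minimizes the mean square distance. Below, q0 is the value that is
    obtained when one variable is left out. *)
Lemma expect_sqr_centered (Q : Omega -> R) (q0 : R) : bmeas Q ->
  \int[P]_w (Q w - \int[P]_w' Q w') ^+ 2 <= \int[P]_w (Q w - q0) ^+ 2.
Proof.
move=> bQ; set m := \int[P]_w Q w.
have bQ2 (c : R) : bmeas (fun w => (Q w - c) ^+ 2).
  by under eq_fun do rewrite expr2; apply: bmeasM; apply: bmeasB => //; exact: bmeas_cst.
rewrite -subr_ge0 -expectB //=.

have -> : \int[P]_w ((Q w - q0) ^+ 2 - (Q w - m) ^+ 2) =
    \int[P]_w ((2 * (m - q0)) * Q w + (q0 ^+ 2 - m ^+ 2)).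
  by congr Rintegral; apply/funext => w; ring.
rewrite expectD; [|exact: bmeasZ|exact: bmeas_cst].
rewrite expectZ // expect_cst -/m.
have -> : 2 * (m - q0) * m + (q0 ^+ 2 - m ^+ 2) = (m - q0) ^+ 2 by ring.
exact: sqr_ge0.
Qed.

(** The envelope phi * c controls both the range of Q, through c <= 1, and its
    variance, through the mean of c ^ 2. As the mean of Q is itself within phi of
    q0, the centred variable has range 2 * phi. *)
Lemma bernstein_mgf (Q c : Omega -> R) (q0 phi lam : R) :
  bmeas Q -> bmeas c -> (forall w, 0 <= c w <= 1) -> 0 <= phi ->
  (forall w, `|Q w - q0| <= phi * c w) -> 0 <= lam -> lam * (2 * phi) < 1 ->
  \int[P]_w expR (lam * Q w) <=
  expR (lam * \int[P]_w Q w +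
    lam ^+ 2 / 2 / (1 - lam * (2 * phi)) * (phi ^+ 2 * \int[P]_w c w ^+ 2)).
Proof.
move=> bQ bc c01 phi0 Qc lam0 lamphi; set m := \int[P]_w Q w.
set K := lam ^+ 2 / 2 / (1 - lam * (2 * phi)).
have K0 : 0 <= K by rewrite divr_ge0 ?divr_ge0 ?sqr_ge0 //; lra.
have bQm : bmeas (fun w => Q w - m) by apply: bmeasB => //; exact: bmeas_cst.
have bQm2 (a : R) : bmeas (fun w => (Q w - a) ^+ 2).
  by under eq_fun do rewrite expr2; apply: bmeasM; apply: bmeasB => //; exact: bmeas_cst.
have bc2 : bmeas (fun w => c w ^+ 2).
  by under eq_fun do rewrite expr2; exact: bmeasM.
have Qphi w : `|Q w - q0| <= phi.
  rewrite (le_trans (Qc w)) // -[leRHS]mulr1 ler_wpM2l //.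
  by case/andP: (c01 w).
have mq0 : `|m - q0| <= phi.
  have -> : m - q0 = \int[P]_w (Q w - q0).
    by rewrite expectB ?expect_cst //; exact: bmeas_cst.
  have bQ0 : bmeas (fun w => Q w - q0) by apply: bmeasB => //; exact: bmeas_cst.
  rewrite (le_trans (expect_norm_le P bQ0)) // -[leRHS](expect_cst P).
  by apply: expect_le => //; [exact: bmeas_norm | exact: bmeas_cst].
have Qm w : `|Q w - m| <= 2 * phi.
  have -> : Q w - m = (Q w - q0) - (m - q0) by ring.
  by rewrite (le_trans (ler_normB _ _)) //; have := Qphi w; lra.
have -> : \int[P]_w expR (lam * Q w) =
    expR (lam * m) * \int[P]_w expR (lam * (Q w - m)).
  rewrite -expectZ; last by apply: bmeas_expR; exact: bmeasZ.
  by congr Rintegral; apply/funext => w; rewrite -expRD; congr expR; ring.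
rewrite expRD ler_wpM2l ?expR_ge0 //.
have pw w : expR (lam * (Q w - m)) <= (1 + lam * (Q w - m)) + K * (Q w - m) ^+ 2.
  have le1 : `|lam * (Q w - m)| <= lam * (2 * phi).
    by rewrite normrM ger0_norm // ler_wpM2l.
  have lt1 : `|lam * (Q w - m)| < 1 by exact: le_lt_trans lamphi.
  rewrite (le_trans (expR_bernstein lt1)) // lerD2l.
  have -> : K * (Q w - m) ^+ 2 =
      (lam * (Q w - m)) ^+ 2 / 2 / (1 - lam * (2 * phi)).
    by rewrite /K exprMn; ring.
  rewrite ler_wpM2l ?divr_ge0 ?sqr_ge0 //.
  by rewrite lef_pV2 ?posrE ?subr_gt0 // lerD2l lerN2.
have := @expect_le _ _ _ P _ _ _ _ pw.
have b1 : bmeas (fun w => 1 + lam * (Q w - m)).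
  by apply: bmeasD; [exact: bmeas_cst | exact: bmeasZ].
have bK : bmeas (fun w => K * (Q w - m) ^+ 2) by exact: bmeasZ.
move=> /(_ _ _)/le_trans; apply.
- by apply: bmeas_expR; exact: bmeasZ.
- exact: bmeasD.
rewrite expectD // expectD; [|exact: bmeas_cst|exact: bmeasZ].
rewrite !expectZ // expectB //; last exact: bmeas_cst.
rewrite !expect_cst -/m subrr mulr0 addr0.
apply: le_trans (expR_ge1Dx _); rewrite lerD2l ler_wpM2l //.
apply: le_trans (expect_sqr_centered q0 bQ) _.
rewrite -expectZ //; apply: expect_le => //; first exact: bmeasZ.
move=> w; rewrite -exprMn -real_normK ?num_real //.
by rewrite ler_pXn2r // ?nnegrE // mulr_ge0 //; case/andP: (c01 w).
Qed.

End bernstein_mgf.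

(** * Concentration of a maximum of sums *)

Section max_abs.
Context (R : realType) (K : finType).
Implicit Types a b : K -> R.

Definition max_abs a : R := \big[Order.max/0]_k `|a k|.

Lemma max_abs_ge0 a : 0 <= max_abs a.
Proof. exact: bigmax_ge_id. Qed.

Lemma le_max_abs a k : `|a k| <= max_abs a.
Proof. exact: (le_bigmax _ (fun k => `|a k|)). Qed.

Lemma max_abs_le a (M : R) : 0 <= M -> (forall k, `|a k| <= M) -> max_abs a <= M.
Proof. by move=> M0 aM; apply/bigmax_leP; split. Qed.

Lemma max_abs_lipschitz a b (M : R) : 0 <= M ->
  (forall k, `|a k - b k| <= M) -> `|max_abs a - max_abs b| <= M.
Proof.
have H a' b' : 0 <= M -> (forall k, `|a' k - b' k| <= M) ->
    max_abs a' <= max_abs b' + M.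
  move=> M0 ab; apply: max_abs_le => [|k]; first by rewrite addr_ge0 ?max_abs_ge0.
  rewrite -[a' k](subrK (b' k)) (le_trans (ler_normD _ _)) // addrC.
  by rewrite lerD ?le_max_abs.
move=> M0 ab; rewrite ler_norml; apply/andP; split.
  by rewrite lerBrDr addrC lerBlDr; apply: H => // k; rewrite distrC.
by rewrite lerBlDl; apply: H.
Qed.

Lemma bmeas_max_abs d (S : measurableType d) (a : K -> S -> R) :
  (forall k, bmeas (a k)) -> bmeas (fun s => max_abs (a^~ s)).
Proof. by move=> ba; apply: bmeas_bigmax => k; exact: bmeas_norm. Qed.

End max_abs.

Section max_concentration.
Context d dT (Omega : measurableType d) (T : measurableType dT) (R : realType)
  (P : probability Omega R) (N : nat) (U : 'I_N -> Omega -> T).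
Hypothesis mU : forall i, measurable_fun setT (U i).
Hypothesis indepU : mutually_independent P U.
Context (K : finType) (x : 'I_N -> K -> T -> R) (c : 'I_N -> T -> R) (phi : R)
  (e : K -> R).
Hypothesis bx : forall i k, bmeas (x i k).
Hypothesis bc : forall i, bmeas (c i).
Hypothesis c01 : forall i u, 0 <= c i u <= 1.
Hypothesis phi0 : 0 <= phi.
Hypothesis xc : forall i k u, `|x i k u| <= phi * c i u.

Let dev (a : 'I_N -> K -> R) : R := max_abs (fun k => \sum_i a i k - e k).

Let bmeas_dev dS (S : measurableType dS) (a : 'I_N -> K -> S -> R) :
  (forall i k, bmeas (a i k)) -> bmeas (fun s => dev (fun i k => a i k s)).
Proof.
move=> ba; apply: bmeas_max_abs => k; apply: bmeasB; last exact: bmeas_cst.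
exact: bmeas_sum.
Qed.

Let X i k w := x i k (U i w).

Let bX i k : bmeas (X i k). Proof. exact: bmeas_comp. Qed.

(** The Doob martingale of the deviation: the first n coordinates are revealed
    and the others averaged over an independent copy. *)
Let M n w := \int[P]_w' dev (fun i k => if (i < n)%N then X i k w else X i k w').

(** Here the n-th coordinate has a sample point of its own, so that it can be
    decoupled from the earlier ones. *)
Let Q n w w' := \int[P]_w'' dev (fun i k => if (i < n)%N then X i k w else
  if (i == n :> nat) then X i k w' else X i k w'').

Let MSE n w : M n.+1 w = Q n w w.
Proof.
rewrite /M /Q; congr Rintegral; apply/funext => w'; congr dev.
apply/funext => i; apply/funext => k; rewrite ltnS leq_eqVlt orbC.
by case: ltnP => //= _; case: eqP.
Qed.

Let bmeas_sigma (J : {set 'I_N}) i k : i \in J ->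
  bmeas (fun s : sigma_of U J => X i k s).
Proof.
move=> iJ; have mUi : measurable_fun setT (U i : sigma_of U J -> T).
  exact: measurable_sigma_of.
exact: (bmeas_comp (bx i k) mUi).
Qed.

Let bmeas_fst d1 d2 (T1 : measurableType d1) (T2 : measurableType d2) (f : T1 -> R) :
  bmeas f -> bmeas (fun s : T1 * T2 => f s.1).
Proof. by move=> bf; apply: (bmeas_comp bf); exact: measurable_fst. Qed.

Let bmeas_snd d1 d2 (T1 : measurableType d1) (T2 : measurableType d2) (f : T2 -> R) :
  bmeas f -> bmeas (fun s : T1 * T2 => f s.2).
Proof. by move=> bf; apply: (bmeas_comp bf); exact: measurable_snd. Qed.

Let expect_Q (n : 'I_N) w : \int[P]_w' Q n w w' = M n w.
Proof.
pose J := [set n]%SET; pose J' := [set i : 'I_N | (n < i)%N]%SET.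
pose F (s : sigma_of U J * sigma_of U J') := dev (fun i k =>
  if (i < n)%N then X i k w else
  if (i == n :> nat) then X i k s.1 else X i k s.2).
have JJ' i : i \in J -> i \notin J' by rewrite !inE => /eqP ->; rewrite ltnn.
have bF : bmeas F.
  apply: bmeas_dev => i k; case: ltnP => // ni; first exact: bmeas_cst.
  case: eqP => [/val_inj ->|/eqP in_neq].
    apply: bmeas_fst; apply: bmeas_sigma; exact: finset.set11.
  apply: bmeas_snd; apply: bmeas_sigma.
  by rewrite inE ltn_neqAle eq_sym in_neq.
rewrite [LHS](_ : _ = \int[P]_w' \int[P]_w'' F (w', w'')) //.
rewrite -(expect_decouple_family mU indepU JJ' bF); last by move=> s; exact: max_abs_ge0.
rewrite /M; congr Rintegral; apply/funext => w'; congr dev.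
apply/funext => i; apply/funext => k; case: ltnP => //= _.
by case: eqP.
Qed.

Let bQ n w : bmeas (Q n w).
Proof.
pose F (s : Omega * Omega) := dev (fun i k =>
  if (i < n)%N then X i k w else
  if (i == n :> nat) then X i k s.1 else X i k s.2).
have bF : bmeas F.
  apply: bmeas_dev => i k; case: (i < n)%N; first exact: bmeas_cst.
  by case: (i == n :> nat); [exact: bmeas_fst | exact: bmeas_snd].
by apply: (bmeas_partial_expectation P bF) => s; exact: max_abs_ge0.
Qed.

Let bM n : bmeas (M n).
Proof.
pose F (s : Omega * Omega) := dev (fun i k =>
  if (i < n)%N then X i k s.1 else X i k s.2).
have bF : bmeas F.
  apply: bmeas_dev => i k.
  by case: (i < n)%N; [exact: bmeas_fst | exact: bmeas_snd].
by apply: (bmeas_partial_expectation P bF) => s; exact: max_abs_ge0.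
Qed.

Let kappa lam (i : 'I_N) := lam ^+ 2 / 2 / (1 - lam * (2 * phi)) *
  (phi ^+ 2 * \int[P]_w c i (U i w) ^+ 2).

Let mgf_Q (lam : R) (n : 'I_N) w : 0 <= lam -> lam * (2 * phi) < 1 ->
  \int[P]_w' expR (lam * Q n w w') <= expR (lam * M n w + kappa lam n).
Proof.
move=> lam0 lamphi; rewrite -expect_Q.
have bcn : bmeas (fun w => c n (U n w)) by exact: (bmeas_comp (bc n) (mU n)).
(* the centre is the same average with the n-th coordinate left out *)
apply: (@bernstein_mgf _ _ _ P (Q n w) (fun w => c n (U n w))
  (\int[P]_w'' dev (fun i k => if (i < n)%N then X i k w else
     if (i == n :> nat) then 0 else X i k w''))) => // w'.
rewrite /Q -expectB.
- set D := (fun w'' => dev _ - dev _).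
  have bD : bmeas D.
    apply: bmeasB; apply: bmeas_dev => i k; case: (i < n)%N; try exact: bmeas_cst;
      by case: (i == n :> nat) => //; exact: bmeas_cst.
  rewrite (le_trans (expect_norm_le P bD)) // -[leRHS](expect_cst P).
  apply: expect_le => [||w'']; [exact: bmeas_norm | exact: bmeas_cst|].
  have phic0 : 0 <= phi * c n (U n w') by rewrite mulr_ge0 //; case/andP: (c01 n (U n w')).
  apply: max_abs_lipschitz => // k.
  rewrite opprB addrA subrK -sumrB (bigD1 n) //= ltnn eqxx subr0.
  rewrite big1 ?addr0; first exact: xc.
  move=> i; rewrite -val_eqE/= => /negbTE ->.
  by case: ifP => _; rewrite subrr.
- apply: bmeas_dev => i k; case: (i < n)%N; first exact: bmeas_cst.
  by case: (i == n :> nat) => //; exact: bmeas_cst.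
- apply: bmeas_dev => i k; case: (i < n)%N; first exact: bmeas_cst.
  by case: (i == n :> nat) => //; exact: bmeas_cst.
Qed.

Let mgf_step (lam : R) (n : 'I_N) : 0 <= lam -> lam * (2 * phi) < 1 ->
  \int[P]_w expR (lam * M n.+1 w) <=
  expR (kappa lam n) * \int[P]_w expR (lam * M n w).
Proof.
move=> lam0 lamphi.
pose J := [set n]%SET; pose J' := [set i : 'I_N | (i < n)%N]%SET.
pose G (s : (sigma_of U J' * sigma_of U J) * Omega) := dev (fun i k =>
  if (i < n)%N then X i k s.1.1 else
  if (i == n :> nat) then X i k s.1.2 else X i k s.2).
have JJ' i : i \in J' -> i \notin J.
  by rewrite !inE => iltn; rewrite neq_ltn iltn.
have bG : bmeas G.
  apply: bmeas_dev => i k; case: ltnP => ni.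
    have b1 : bmeas (fun s : sigma_of U J' * sigma_of U J => X i k s.1).
      by apply: bmeas_fst; apply: bmeas_sigma; rewrite inE.
    exact: (@bmeas_fst _ _ _ _ _ b1).
  case: eqP => [/val_inj ->|_]; last exact: bmeas_snd.
  have b2 : bmeas (fun s : sigma_of U J' * sigma_of U J => X n k s.2).
    by apply: bmeas_snd; apply: bmeas_sigma; exact: finset.set11.
  exact: (@bmeas_fst _ _ _ _ _ b2).
pose F (s : sigma_of U J' * sigma_of U J) := expR (lam * \int[P]_w G (s, w)).
have bF : bmeas F.
  apply: bmeas_expR; apply: bmeasZ.
  by apply: bmeas_partial_expectation => // s; exact: max_abs_ge0.
rewrite [leLHS](_ : _ = \int[P]_w F (w, w)); last first.
  by congr Rintegral; apply/funext => w; rewrite MSE.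
rewrite (expect_decouple_family mU indepU JJ' bF); last by move=> s; exact: expR_ge0.
rewrite -expectZ; last by apply: bmeas_expR; exact: bmeasZ.
apply: expect_le => [||w].
- apply: (bmeas_partial_expectation P (F := fun s : Omega * Omega =>
    expR (lam * Q n s.1 s.2))) => [|s]; last exact: expR_ge0.
  apply: bmeas_expR; apply: bmeasZ.
  pose G' (s : (Omega * Omega) * Omega) := dev (fun i k =>
    if (i < n)%N then X i k s.1.1 else
    if (i == n :> nat) then X i k s.1.2 else X i k s.2).
  have bG' : bmeas G'.
    apply: bmeas_dev => i k; case: (i < n)%N.
      exact: (@bmeas_fst _ _ _ _ _ (@bmeas_fst _ _ _ Omega _ (bX i k))).
    case: (i == n :> nat); last exact: bmeas_snd.
    exact: (@bmeas_fst _ _ _ _ _ (@bmeas_snd _ _ Omega _ _ (bX i k))).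
  apply: (bmeas_partial_expectation P bG') => s; exact: max_abs_ge0.
- by apply: bmeasZ; apply: bmeas_expR; exact: bmeasZ.
- by rewrite mulrC -expRD; exact: mgf_Q.
Qed.

Let mgf_M (lam : R) (n : nat) : 0 <= lam -> lam * (2 * phi) < 1 -> (n <= N)%N ->
  \int[P]_w expR (lam * M n w) <=
  expR (lam * \int[P]_w dev (fun i k => X i k w) +
        \sum_(i < N | (i < n)%N) kappa lam i).
Proof.
move=> lam0 lamphi; elim: n => [_|n IH nN].
  by rewrite big_pred0 // addr0 -[leRHS](expect_cst P); exact: lexx.
apply: le_trans (mgf_step (Ordinal nN) lam0 lamphi) _.
apply: le_trans (ler_wpM2l (expR_ge0 _) (IH (ltnW nN))) _.
rewrite -expRD ler_expR addrCA lerD2l.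
rewrite [leRHS](bigD1 (Ordinal nN)) //= lerD2l le_eqVlt; apply/orP; left.
apply/eqP/eq_bigl => i; rewrite ltnS -val_eqE /= andbC.
by rewrite ltn_neqAle.
Qed.

(** Bernstein's inequality for a maximum of sums. Leaving out the i-th variable moves
    the maximum by at most phi * c i, whatever the index of the maximum is, so the
    increments of the Doob martingale inherit the range and the variance of the
    envelope, and the exponential moment grows by one factor per coordinate. *)
Lemma mgf_max_deviation (lam : R) : 0 <= lam -> lam * (2 * phi) < 1 ->
  \int[P]_w expR (lam * max_abs (fun k => \sum_i x i k (U i w) - e k)) <=
  expR (lam * \int[P]_w max_abs (fun k => \sum_i x i k (U i w) - e k) +
    lam ^+ 2 / 2 / (1 - lam * (2 * phi)) *
    (phi ^+ 2 * \sum_i \int[P]_w c i (U i w) ^+ 2)).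
Proof.
move=> lam0 lamphi; have := mgf_M lam0 lamphi (leqnn N).
congr (_ <= expR (_ + _)).
  congr Rintegral; apply/funext => w; congr (expR (lam * _)).
  rewrite /M -[RHS](expect_cst P); congr Rintegral; apply/funext => w'.
  by congr dev; apply/funext => i; apply/funext => k; rewrite ltn_ord.
rewrite /kappa -!mulr_sumr; do 2 congr (_ * _).
by apply: eq_bigl => i; rewrite ltn_ord.
Qed.

End max_concentration.

(** * Bernstein and Hoeffding tails *)

Section tails.
Context d (Omega : measurableType d) (R : realType) (P : probability Omega R).

Lemma measurable_superlevel (Z : Omega -> R) (t : R) : measurable_fun setT Z ->
  measurable [set w | t < Z w].
Proof.
move=> mZ; rewrite -[X in measurable X]setTI.
have -> : [set w | t < Z w] = Z @^-1` `]t, +oo[%classic.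
  by apply/seteqP; split => w /=; rewrite in_itv/= andbT.
exact: mZ.
Qed.

Lemma chernoff_bound (Z : Omega -> R) (lam t : R) : bmeas Z -> 0 <= lam ->
  (P [set w | t < Z w]%R <= (expR (- (lam * t)) * \int[P]_w expR (lam * Z w))%:E)%E.
Proof.
move=> bZ lam0; set A := [set w | (t < Z w)%R].
have mA : measurable A by apply: measurable_superlevel; case: bZ.
have bA : bmeas (\1_A : Omega -> R).
  split; first exact: measurable_indic.
  by exists 1 => w; rewrite indicE; case: (_ \in _); rewrite ?normr1 ?normr0.
have -> : P A = (\int[P]_w \1_A w)%:E.
  by rewrite EFin_expect // integral_indic // setIT.
rewrite lee_fin -expectZ; last by apply: bmeas_expR; exact: bmeasZ.
apply: expect_le => //.
  by apply: bmeasZ; apply: bmeas_expR; exact: bmeasZ.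
move=> w; rewrite indicE; case: (boolP (w \in A)) => [|_].
  rewrite inE /A /= => tZ; rewrite -expRD -[leLHS]expR0 ler_expR.
  by rewrite addrC subr_ge0 ler_wpM2l // ltW.
by rewrite mulr_ge0 ?expR_ge0.
Qed.

(** With s = sqrt (2 x / v) and lam = s / (1 + b s), the exponent in Chernoff's bound
    is exactly - x. *)
Lemma bernstein_tail (Z : Omega -> R) (v b x : R) : bmeas Z -> 0 < v -> 0 <= b ->
  0 <= x ->
  (forall lam, 0 <= lam -> lam * b < 1 ->
    \int[P]_w expR (lam * Z w) <=
    expR (lam * \int[P]_w Z w + lam ^+ 2 / 2 / (1 - lam * b) * v)) ->
  (P [set w | \int[P]_w Z w + Num.sqrt (2 * v * x) + b * x < Z w]%R <=
   (expR (- x))%:E)%E.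
Proof.
move=> bZ v0 b0 x0 mgf.
pose s := Num.sqrt (2 * x / v).
have s0 : 0 <= s by exact: sqrtr_ge0.
have xE : x = s ^+ 2 * v / 2.
  rewrite /s sqr_sqrtr; first by field; rewrite gt_eqF.
  by rewrite divr_ge0 ?(ltW v0) // mulr_ge0.
have -> : Num.sqrt (2 * v * x) = s * v.
  have -> : 2 * v * x = (s * v) ^+ 2 by rewrite xE; field.
  by rewrite sqrtr_sqr ger0_norm // mulr_ge0 // ltW.
have bs0 : 0 <= b * s by exact: mulr_ge0.
pose lam := s / (1 + b * s).
have lam0 : 0 <= lam by rewrite divr_ge0 // addr_ge0.
have lamb : lam * b < 1.
  by rewrite /lam mulrAC ltr_pdivrMr ?mul1r; [rewrite mulrC; lra | lra].
apply: le_trans (chernoff_bound _ bZ lam0) _.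
rewrite lee_fin.
apply: le_trans (ler_wpM2l (expR_ge0 _) (mgf _ lam0 lamb)) _.
rewrite -expRD ler_expR.
set m := \int[P]_w Z w.
have -> : 1 - lam * b = (1 + b * s)^-1.
  by rewrite /lam; field; rewrite gt_eqF //; lra.
rewrite xE /lam le_eqVlt; apply/orP; left; apply/eqP; field.
by rewrite gt_eqF //; lra.
Qed.

End tails.

Section hoeffding.
Context d dT (Omega : measurableType d) (T : measurableType dT) (R : realType)
  (P : probability Omega R) (N : nat) (U : 'I_N -> Omega -> T).
Hypothesis mU : forall i, measurable_fun setT (U i).
Hypothesis indepU : mutually_independent P U.

Lemma expect_prod (g : 'I_N -> T -> R) :
  (forall i, bmeas (g i)) -> (forall i u, 0 <= g i u) ->
  \int[P]_w \prod_i g i (U i w) = \prod_i \int[P]_w g i (U i w).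
Proof.
move=> bg g0.
have bgU i : bmeas (fun w => g i (U i w)) by exact: (bmeas_comp (bg i) (mU i)).
have bprod dS (S : measurableType dS) (f : 'I_N -> S -> R) (J : pred 'I_N) :
    (forall i, J i -> bmeas (f i)) -> bmeas (fun s => \prod_(i | J i) f i s).
  move=> bf; elim: (index_enum _) => [|i s IH].
    by under eq_fun do rewrite big_nil; exact: bmeas_cst.
  case Ji: (J i); last by under eq_fun do rewrite big_cons Ji.
  by under eq_fun do rewrite big_cons Ji; apply: bmeasM => //; exact: bf.
suff H n : (n <= N)%N -> \int[P]_w \prod_(i < N | (i < n)%N) g i (U i w) =
    \prod_(i < N | (i < n)%N) \int[P]_w g i (U i w).
  have := H N (leqnn N); have E (F : 'I_N -> R) :
      \prod_(i < N | (i < N)%N) F i = \prod_i F i.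
    by apply: eq_bigl => i; rewrite ltn_ord.
  by rewrite E => <-; congr Rintegral; apply/funext => w; rewrite E.
elim: n => [_|n IH nN].
  rewrite big_pred0 // -[RHS](expect_cst P).
  by congr Rintegral; apply/funext => w; rewrite big_pred0.
pose i0 := Ordinal nN.
have E (F : 'I_N -> R) : \prod_(i < N | (i < n.+1)%N) F i =
    F i0 * \prod_(i < N | (i < n)%N) F i.
  rewrite (bigD1 i0) //=; congr (_ * _); apply: eq_bigl => i.
  by rewrite ltnS -val_eqE /= andbC [RHS]ltn_neqAle.
rewrite E -IH ?(ltnW nN) //.
pose J := [set i : 'I_N | (i < n)%N]%SET; pose J' := [set i0]%SET.
have JJ' i : i \in J -> i \notin J'.
  by rewrite !inE => iltn; rewrite -val_eqE /= neq_ltn iltn.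
have mUs (L : {set 'I_N}) i : i \in L -> measurable_fun setT (U i : sigma_of U L -> T).
  exact: measurable_sigma_of.
pose F (s : sigma_of U J * sigma_of U J') :=
  g i0 (U i0 s.2) * \prod_(i < N | (i < n)%N) g i (U i s.1).
have bF : bmeas F.
  apply: bmeasM.
    have b0 := bmeas_comp (bg i0) (mUs J' i0 (finset.set11 i0)).
    exact: (bmeas_comp b0 measurable_snd).
  have bp : bmeas (fun s : sigma_of U J => \prod_(i < N | (i < n)%N) g i (U i s)).
    apply: bprod => i iltn; apply: (bmeas_comp (bg i)).
    by apply: mUs; rewrite inE.
  exact: (bmeas_comp bp measurable_fst).
rewrite [LHS](_ : _ = \int[P]_w F (w, w)); last first.
  by congr Rintegral; apply/funext => w; rewrite E.
rewrite (expect_decouple_family mU indepU JJ' bF); last first.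
  by move=> s; rewrite mulr_ge0 //; apply: prodr_ge0.
rewrite -expectZ; last exact: bprod.
congr Rintegral; apply/funext => w; rewrite mulrC -expectZ //.
by congr Rintegral; apply/funext => w'; rewrite mulrC.
Qed.

(** On [-F, F] the exponential lies below its chord, which replaces X by the
    two-point variable on {-F, F} of the same mean. *)
Lemma hoeffding_mgf (X : Omega -> R) (F lam : R) : 0 <= F -> bmeas X ->
  (forall w, `|X w| <= F) ->
  \int[P]_w expR (lam * (X w - \int[P]_w X w)) <= expR ((lam * F) ^+ 2 / 2).
Proof.
move=> F0 bX XF; set m := \int[P]_w X w.
have [F_eq0|Fneq0] := eqVneq F 0.
  have X0 w : X w = 0 by apply/eqP; have := XF w; rewrite F_eq0 normr_le0.
  have m0 : m = 0.
    by rewrite /m -[RHS](expect_cst P); congr Rintegral; apply/funext.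
  rewrite m0 F_eq0 mulr0 expr0n /= mul0r expR0 -[leRHS](expect_cst P).
  apply: expect_le; [|exact: bmeas_cst|].
    by apply: bmeas_expR; apply: bmeasZ; apply: bmeasB => //; exact: bmeas_cst.
  by move=> w; rewrite X0 subr0 mulr0 expR0.
have Fgt0 : 0 < F by rewrite lt_def Fneq0.
have XF1 w : -1 <= X w / F <= 1.
  by rewrite -ler_norml normrM normfV (ger0_norm F0) ler_pdivrMr // mul1r.
have bXF : bmeas (fun w => (X w / F)).
  by apply: bmeasM => //; exact: bmeas_cst.
have mE : \int[P]_w (X w / F) = m / F.
  rewrite mulrC -expectZ //; congr Rintegral; apply/funext => w; exact: mulrC.
have mF1 : -1 <= m / F <= 1.
  rewrite -ler_norml -mE; apply: le_trans (expect_norm_le P bXF) _.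
  rewrite -[leRHS](expect_cst P); apply: expect_le.
  - exact: bmeas_norm.
  - exact: bmeas_cst.
  - by move=> w; rewrite ler_norml.
set t := lam * F.
have -> : \int[P]_w expR (lam * (X w - m)) =
    expR (- (m / F * t)) * \int[P]_w expR (t * (X w / F)).
  rewrite -expectZ; last by apply: bmeas_expR; exact: bmeasZ.
  congr Rintegral; apply/funext => w; rewrite -expRD; congr expR.
  by rewrite /t; field.
have step : \int[P]_w expR (t * (X w / F)) <=
    (1 + m / F) / 2 * expR t + (1 - m / F) / 2 * expR (- t).
  pose c1 := (expR t - expR (- t)) / 2; pose c0 := (expR t + expR (- t)) / 2.
  have -> : (1 + m / F) / 2 * expR t + (1 - m / F) / 2 * expR (- t) =
      \int[P]_w (c1 * (X w / F) + c0).
    rewrite expectD; [|exact: bmeasZ|exact: bmeas_cst].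
    by rewrite expectZ // expect_cst mE /c1 /c0; field.
  apply: expect_le.
  - by apply: bmeas_expR; exact: bmeasZ.
  - by apply: bmeasD; [exact: bmeasZ | exact: bmeas_cst].
  - move=> w; apply: le_trans (expR_convex_chord t (XF1 w)) _.
    by rewrite le_eqVlt; apply/orP; left; apply/eqP; rewrite /c1 /c0; field.
apply: le_trans (ler_wpM2l (expR_ge0 _) (le_trans step (hoeffding_two_point t mF1))) _.
by rewrite -expRD addKr.
Qed.

Lemma hoeffding_tail (x : 'I_N -> T -> R) (F y : R) : (0 < N)%N -> 0 <= y ->
  0 <= F -> (forall i, bmeas (x i)) -> (forall i u, `|x i u| <= F) ->
  (P [set w | F * Num.sqrt (2 * N%:R * y) <
    \sum_i (x i (U i w) - \int[P]_w' x i (U i w'))]%R <= (expR (- y))%:E)%E.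
Proof.
move=> N0 y0 F0 bx xF.
have bxU i : bmeas (fun w => x i (U i w)) by exact: (bmeas_comp (bx i) (mU i)).
pose m i := \int[P]_w' x i (U i w').
have [F_eq0|Fneq0] := eqVneq F 0.
  rewrite [X in P X](_ : _ = set0) ?measure0 ?lee_fin ?expR_ge0 //.
  apply/seteqP; split => // w /=.
  have x0 i u : x i u = 0 by apply/eqP; have := xF i u; rewrite F_eq0 normr_le0.
  rewrite F_eq0 mul0r big1 ?ltxx // => i _; rewrite x0 sub0r; apply/eqP.
  rewrite oppr_eq0; apply/eqP; rewrite -[RHS](expect_cst P).
  by congr Rintegral; apply/funext => w'; rewrite x0.
have Fgt0 : 0 < F by rewrite lt_def Fneq0.
have NR : 0 < N%:R :> R by rewrite ltr0n.
pose s := Num.sqrt (2 * N%:R * y).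
have s2 : s ^+ 2 = 2 * N%:R * y by rewrite sqr_sqrtr // !mulr_ge0.
pose lam := s / N%:R / F.
have lam0 : 0 <= lam by rewrite !divr_ge0 // sqrtr_ge0.
have bZ : bmeas (fun w => \sum_i (x i (U i w) - m i)).
  by apply: bmeas_sum => i; apply: bmeasB => //; exact: bmeas_cst.
apply: le_trans (chernoff_bound P _ bZ lam0) _.
rewrite lee_fin.
have -> : \int[P]_w expR (lam * \sum_i (x i (U i w) - m i)) =
    \prod_i \int[P]_w expR (lam * (x i (U i w) - m i)).
  rewrite -(@expect_prod (fun i u => expR (lam * (x i u - m i)))).
  - by congr Rintegral; apply/funext => w; rewrite mulr_sumr expR_sum.
  - by move=> i; apply: bmeas_expR; apply: bmeasZ; apply: bmeasB => //; exact: bmeas_cst.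
  - by move=> i u; exact: expR_ge0.
have : \prod_i \int[P]_w expR (lam * (x i (U i w) - m i)) <=
    \prod_(i < N) expR ((lam * F) ^+ 2 / 2).
  apply: ler_prod => i _; apply/andP; split.
    by apply: Rintegral_ge0 => w _; exact: expR_ge0.
  by apply: hoeffding_mgf => // w; exact: xF.
move=> /(ler_wpM2l (expR_ge0 _))/le_trans; apply.
rewrite -expR_sum sumr_const card_ord -expRD ler_expR -[X in _ + X]mulr_natr.
have -> : lam * F = s / N%:R by rewrite /lam divfK.
rewrite -[Num.sqrt _]/s.
have -> : lam * (F * s) = s ^+ 2 / N%:R by rewrite /lam; field; rewrite !gt_eqF.
rewrite exprMn s2 le_eqVlt; apply/orP; left; apply/eqP; field.
by rewrite gt_eqF.
Qed.

End hoeffding.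

(** * Rademacher averages *)

Section rademacher.
Context (R : realType) (N : nat).
Implicit Types eps : {ffun 'I_N -> bool}.

Definition sgb (b : bool) : R := (-1) ^+ b.

Lemma sgbN b : sgb (~~ b) = - sgb b.
Proof. by case: b; rewrite /sgb /= ?expr0 ?expr1 ?opprK. Qed.

Lemma normr_sgb b : `|sgb b| = 1.
Proof. exact: normr_sign. Qed.

Definition average_signs (F : {ffun 'I_N -> bool} -> R) : R :=
  (\sum_eps F eps) / 2 ^+ N.

Let twoN_gt0 : 0 < 2 ^+ N :> R. Proof. by rewrite exprn_gt0. Qed.

Lemma average_signs_le F G : (forall eps, F eps <= G eps) ->
  average_signs F <= average_signs G.
Proof. by move=> FG; rewrite ler_pM2r ?invr_gt0 // ler_sum. Qed.

Lemma average_signs_cst (a : R) : average_signs (fun=> a) = a.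
Proof.
rewrite /average_signs sumr_const card_ffun card_bool card_ord.
rewrite -[X in X / _]mulr_natr natrX.
by rewrite mulfK ?gt_eqF.
Qed.

Lemma average_signsZ (a : R) F :
  average_signs (fun eps => a * F eps) = a * average_signs F.
Proof. by rewrite /average_signs -mulr_sumr mulrA. Qed.

Lemma average_signsD F G :
  average_signs (fun eps => F eps + G eps) = average_signs F + average_signs G.
Proof. by rewrite /average_signs big_split mulrDl. Qed.

Definition flip (n : 'I_N) eps : {ffun 'I_N -> bool} :=
  [ffun i => eps i (+) (i == n)].

Lemma flipK n : involutive (flip n).
Proof. by move=> eps; apply/ffunP => i; rewrite !ffunE -addbA addbb addbF. Qed.

Lemma flip_at n eps : flip n eps n = ~~ eps n.
Proof. by rewrite ffunE eqxx addbT. Qed.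

Lemma flip_other n eps i : i != n -> flip n eps i = eps i.
Proof. by move=> /negbTE inE; rewrite ffunE inE addbF. Qed.

Lemma average_signs_flip n F :
  average_signs (fun eps => F (flip n eps)) = average_signs F.
Proof.
congr (_ / _); rewrite [RHS](reindex_inj (inv_inj (flipK n))).
exact: eq_bigr.
Qed.

(** The flip permutes the sign vectors, so each average may be taken over the pairs
    of a sign vector and its flip. *)
Lemma average_signs_le_flip n F G :
  (forall eps, F eps + F (flip n eps) <= G eps + G (flip n eps)) ->
  average_signs F <= average_signs G.
Proof.
move=> FG; have := average_signs_le FG.
by rewrite !average_signsD !average_signs_flip; lra.
Qed.

Lemma average_signs_opp F :
  average_signs (fun eps => F [ffun i => ~~ eps i]) = average_signs F.
Proof.
have negK : involutive (fun eps : {ffun 'I_N -> bool} => [ffun i => ~~ eps i]).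
  by move=> eps; apply/ffunP => i; rewrite !ffunE negbK.
by congr (_ / _); rewrite [RHS](reindex_inj (inv_inj negK)).
Qed.

Lemma rademacher_mgf (a : 'I_N -> R) (lam : R) :
  average_signs (fun eps => expR (lam * \sum_i sgb (eps i) * a i)) <=
  expR (lam ^+ 2 * (\sum_i a i ^+ 2) / 2).
Proof.
rewrite /average_signs ler_pdivrMr //.
pose f (i : 'I_N) (b : bool) := expR (lam * (sgb b * a i)).
have -> : \sum_(eps : {ffun 'I_N -> bool}) expR (lam * \sum_i sgb (eps i) * a i) =
    \sum_(eps : {ffun 'I_N -> bool}) \prod_i f i (eps i).
  by apply: eq_bigr => eps _; rewrite mulr_sumr expR_sum.
rewrite -(bigA_distr_bigA f).
have -> : expR (lam ^+ 2 * (\sum_i a i ^+ 2) / 2) * 2 ^+ N =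
    \prod_(i < N) (expR ((lam * a i) ^+ 2 / 2) * 2).
  rewrite big_split /= prodr_const card_ord -expR_sum; congr (expR _ * _).
  by rewrite -mulrA mulr_suml mulr_sumr; apply: eq_bigr => i _; rewrite exprMn mulrA.
apply: ler_prod => i _; rewrite big_bool /f /sgb /= expr1 expr0 mul1r mulN1r mulrN.
rewrite addr_ge0 ?expR_ge0 //=.
have := expR_average_sign (lam * a i).
by rewrite ler_pdivrMr // addrC.
Qed.

Lemma max_abs_attained (K : finType) (k0 : K) (a : K -> R) :
  exists k, max_abs a = `|a k|.
Proof.
have [k _ kmax] := @Order.TotalTheory.arg_maxP _ _ K k0 xpredT (fun k => `|a k|) isT.
exists k; apply/eqP; rewrite eq_le le_max_abs andbT.
by apply: max_abs_le => // k'; exact: kmax.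
Qed.

(** The exponential of the maximum is at most the sum of the exponentials of the
    2 * #|J| signed sums. *)
Lemma rademacher_max (J : finType) (j0 : J) (a : 'I_N -> J -> R) (sigma : R) :
  0 <= sigma -> (forall j, \sum_i a i j ^+ 2 <= sigma ^+ 2) ->
  average_signs (fun eps => max_abs (fun j => \sum_i sgb (eps i) * a i j)) <=
  sigma * Num.sqrt (2 * ln (2 * #|J|%:R)).
Proof.
move=> sigma0 asigma.
have [sigma_eq0|sigma_neq0] := eqVneq sigma 0.
  rewrite sigma_eq0 mul0r -[leRHS](average_signs_cst 0).
  apply: average_signs_le => eps; apply: max_abs_le => // j.
  rewrite big1 ?normr0 // => i _; suff -> : a i j = 0 by rewrite mulr0.
  apply/eqP; rewrite -sqrf_eq0 eq_le sqr_ge0 andbT.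
  apply: le_trans (_ : \sum_i a i j ^+ 2 <= 0).
    by rewrite (bigD1 i) //= lerDl sumr_ge0 // => l _; exact: sqr_ge0.
  by rewrite (le_trans (asigma j)) // sigma_eq0 expr0n.
have sigma_gt0 : 0 < sigma by rewrite lt_def sigma_neq0.
have J1 : 1 <= #|J|%:R :> R by rewrite ler1n; apply/card_gt0P; exists j0.
have lnJ : 0 < ln (2 * #|J|%:R) :> R by rewrite ln_gt0 //; lra.
pose r := Num.sqrt (2 * ln (2 * #|J|%:R)) : R.
have r0 : 0 < r by rewrite sqrtr_gt0 mulr_gt0.
have r2 : r ^+ 2 = 2 * ln (2 * #|J|%:R) by rewrite sqr_sqrtr // ltW // mulr_gt0.
pose lam := r / sigma.
have lam0 : 0 < lam by exact: divr_gt0.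
pose L := ln (2 * #|J|%:R) + lam ^+ 2 * sigma ^+ 2 / 2.
pose y eps := max_abs (fun j => \sum_i sgb (eps i) * a i j).
have ymgf eps : expR (lam * y eps) <=
    \sum_j (expR (lam * \sum_i sgb (eps i) * a i j) +
            expR ((- lam) * \sum_i sgb (eps i) * a i j)).
  rewrite /y; have [j ->] := max_abs_attained j0 (fun j => \sum_i sgb (eps i) * a i j).
  rewrite (bigD1 j) //=; apply: ler_wpDr.
    by apply: sumr_ge0 => l _; rewrite addr_ge0 ?expR_ge0.
  case: (ger0P (\sum_i sgb (eps i) * a i j)) => _.
    by rewrite lerDl expR_ge0.
  by rewrite mulrN mulNr lerDr expR_ge0.
have avgmgf : average_signs (fun eps => expR (lam * y eps)) <= expR L.
  apply: le_trans (average_signs_le ymgf) _.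
  have -> : average_signs (fun eps => \sum_j (expR (lam * \sum_i sgb (eps i) * a i j) +
            expR ((- lam) * \sum_i sgb (eps i) * a i j))) =
      \sum_j (average_signs (fun eps => expR (lam * \sum_i sgb (eps i) * a i j)) +
       average_signs (fun eps => expR ((- lam) * \sum_i sgb (eps i) * a i j))).
    rewrite /average_signs exchange_big /= mulr_suml; apply: eq_bigr => j _.
    by rewrite big_split mulrDl.
  have -> : expR L = \sum_(j : J) (2 * expR (lam ^+ 2 * sigma ^+ 2 / 2)).
    rewrite expRD lnK ?posrE; last by lra.
    by rewrite sumr_const -[RHS]mulr_natl mulrA [in RHS](mulrC _ 2).
  apply: ler_sum => j _; rewrite mulr_natl mulr2n.
  by apply: lerD; apply: le_trans (rademacher_mgf _ _) _;
    rewrite ler_expR ?sqrrN ler_wpM2r // ler_wpM2l // sqr_ge0.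
(* the tangent of the exponential at L plays the part of Jensen's inequality *)
have lin eps : lam * y eps <= (L - 1) + expR (- L) * expR (lam * y eps).
  by rewrite -expRD; have := expR_ge1Dx (- L + lam * y eps); lra.
have := average_signs_le lin.
rewrite average_signsD average_signs_cst !average_signsZ.
have : expR (- L) * average_signs (fun eps => expR (lam * y eps)) <= 1.
  rewrite -[leRHS]expR0 -(addNr L) expRD ler_wpM2l ?expR_ge0 //.
move=> h1 h2.
have : lam * average_signs y <= L by move: h1 h2; lra.
rewrite mulrC -ler_pdivlMr // => /le_trans; apply.
rewrite -[Num.sqrt _]/r /L.
have -> : ln (2 * #|J|%:R) = r ^+ 2 / 2 by rewrite r2; field.
rewrite le_eqVlt; apply/orP; left; apply/eqP; rewrite /lam; field.
by rewrite !gt_eqF.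
Qed.

End rademacher.

Section contraction.
Context (R : realType) (K : finType) (k0 : K).

Let max0 (a : K -> R) : R := \big[Order.max/0]_k a k.

Let le_max0 a k : a k <= max0 a.
Proof. exact: (le_bigmax _ a). Qed.

Let max0_attained a : a k0 = 0 -> exists k, max0 a = a k.
Proof.
move=> ak0.
have [k _ kmax] := @Order.TotalTheory.arg_maxP _ _ K k0 xpredT a isT.
exists k; apply/eqP; rewrite eq_le le_max0 andbT.
by apply/bigmax_leP; split => [|k' _]; [rewrite -ak0|]; exact: kmax.
Qed.

(** If the maxima on the left are attained at k and k', the two terms f k - f k' are
    exchanged for |t k - t k'|, which the right-hand side reaches by giving k and
    k' to its two maxima in one order or the other. *)
Let contraction2 (B f t : K -> R) :
  B k0 = 0 -> f k0 = 0 -> t k0 = 0 ->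
  (forall k k', `|f k - f k'| <= `|t k - t k'|) ->
  max0 (fun k => B k + f k) + max0 (fun k => B k - f k) <=
  max0 (fun k => B k + t k) + max0 (fun k => B k - t k).
Proof.
move=> Bk0 fk0 tk0 ft.
have [|k ->] := @max0_attained (fun k => B k + f k); first by rewrite Bk0 fk0 addr0.
have [|k' ->] := @max0_attained (fun k => B k - f k); first by rewrite Bk0 fk0 subr0.
have h1 := le_max0 (fun k => B k + t k) k.
have h2 := le_max0 (fun k => B k - t k) k.
have h3 := le_max0 (fun k => B k + t k) k'.
have h4 := le_max0 (fun k => B k - t k) k'.
have := le_trans (ler_norm _) (ft k k').
move: h1 h2 h3 h4 => /=.
by case: (ger0P (t k - t k')) => _; lra.
Qed.

Variables (N : nat) (f t : 'I_N -> K -> R) (psi : R).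
Hypothesis psi0 : 0 <= psi.
Hypothesis fk0 : forall i, f i k0 = 0.
Hypothesis tk0 : forall i, t i k0 = 0.
Hypothesis ft : forall i k k', `|f i k - f i k'| <= psi * `|t i k - t i k'|.

Let g n (i : 'I_N) k := if (i < n)%N then psi * t i k else f i k.

Let gk0 n i : g n i k0 = 0.
Proof. by rewrite /g tk0 fk0 mulr0 if_same. Qed.

Let H n (eps : {ffun 'I_N -> bool}) :=
  max0 (fun k => \sum_i sgb R (eps i) * g n i k).

Let contraction_step (n : 'I_N) : average_signs (H n) <= average_signs (H n.+1).
Proof.
apply: (@average_signs_le_flip _ _ n) => eps.
pose B k := \sum_(i | i != n) sgb R (eps i) * g n i k.
have HE m (e : {ffun 'I_N -> bool}) : (forall i, i != n -> e i = eps i) ->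
    (forall i k, i != n -> g m i k = g n i k) ->
    H m e = max0 (fun k => B k + sgb R (e n) * g m n k).
  move=> e_eps gm; rewrite /H; congr max0; apply/funext => k.
  rewrite (bigD1 n) //= addrC; congr (_ + _).
  by apply: eq_bigr => i i_n; rewrite e_eps // gm.
have gS i k : i != n -> g n.+1 i k = g n i k.
  by move=> i_n; rewrite /g ltnS leq_eqVlt val_eqE (negbTE i_n).
have fl i : i != n -> flip n eps i = eps i by exact: flip_other.
rewrite !HE // flip_at sgbN.
have -> : (fun k => B k + - sgb R (eps n) * g n n k) =
    (fun k => B k - sgb R (eps n) * g n n k).
  by apply/funext => k; rewrite mulNr.
have -> : (fun k => B k + - sgb R (eps n) * g n.+1 n k) =
    (fun k => B k - sgb R (eps n) * g n.+1 n k).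
  by apply/funext => k; rewrite mulNr.
apply: contraction2; rewrite ?gk0 ?mulr0 //.
  by rewrite /B big1 // => i _; rewrite gk0 mulr0.
move=> k k'; rewrite -!mulrBr !normrM !normr_sgb !mul1r.
by rewrite /g ltnn ltnSn -mulrBr normrM (ger0_norm psi0).
Qed.

(** The comparison theorem of Ledoux and Talagrand. The factor 2 comes from the
    absolute value, bounded by the sum of the positive parts at eps and at the
    opposite signs. *)
Lemma rademacher_contraction :
  average_signs (fun eps => max_abs (fun k => \sum_i sgb R (eps i) * f i k)) <=
  2 * psi *
  average_signs (fun eps => max_abs (fun k => \sum_i sgb R (eps i) * t i k)).
Proof.
have chain n : (n <= N)%N -> average_signs (H 0) <= average_signs (H n).
  elim: n => // n IH nN; apply: le_trans (IH (ltnW nN)) _.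
  exact: (contraction_step (Ordinal nN)).
have H0E eps : H 0 eps = max0 (fun k => \sum_i sgb R (eps i) * f i k) by [].
have HNE eps : H N eps <= psi * max_abs (fun k => \sum_i sgb R (eps i) * t i k).
  apply/bigmax_leP; split => [|k _]; first by rewrite mulr_ge0 // max_abs_ge0.
  have -> : \sum_i sgb R (eps i) * g N i k = psi * \sum_i sgb R (eps i) * t i k.
    by rewrite mulr_sumr; apply: eq_bigr => i _; rewrite /g ltn_ord mulrCA.
  rewrite ler_wpM2l //.
  exact: le_trans (ler_norm _) (le_max_abs (fun k => \sum_i sgb R (eps i) * t i k) k).
have absE (eps : {ffun 'I_N -> bool}) : max_abs (fun k => \sum_i sgb R (eps i) * f i k) <=
    H 0 eps + H 0 [ffun i => ~~ eps i].
  have pos e : 0 <= H 0 e by exact: bigmax_ge_id.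
  have opp k : \sum_i sgb R ([ffun i => ~~ eps i] i) * f i k =
      - \sum_i sgb R (eps i) * f i k.
    by rewrite -sumrN; apply: eq_bigr => i _; rewrite ffunE sgbN mulNr.
  apply: max_abs_le => [|k]; first by rewrite addr_ge0.
  case: (ger0P (\sum_i sgb R (eps i) * f i k)) => _.
    rewrite -[leLHS]addr0 lerD //.
    exact: (le_max0 (fun k => \sum_i sgb R (eps i) * f i k)).
  rewrite -[leLHS]add0r lerD // -opp.
  exact: (le_max0 (fun k => \sum_i sgb R ([ffun i => ~~ eps i] i) * f i k)).
apply: le_trans (average_signs_le absE) _.
rewrite average_signsD average_signs_opp.
have := le_trans (chain N (leqnn N)) (average_signs_le HNE).
by rewrite average_signsZ; lra.
Qed.

End contraction.

(** * Symmetrization and the expected maximum *)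

Section symmetrization.
Context d dT (Omega : measurableType d) (T : measurableType dT) (R : realType)
  (P : probability Omega R) (N : nat) (U : 'I_N -> Omega -> T).
Hypothesis mU : forall i, measurable_fun setT (U i).
Hypothesis indepU : mutually_independent P U.
Context (K : finType) (x : 'I_N -> K -> T -> R).
Hypothesis bx : forall i k, bmeas (x i k).

Let X i k w := x i k (U i w).

Let bX i k : bmeas (X i k). Proof. exact: bmeas_comp. Qed.

Let m i k := \int[P]_w X i k w.

(** The i-th summand, when the coordinates below n have been symmetrized. *)
Let y n (eps : {ffun 'I_N -> bool}) (i : 'I_N) k (u : T) :=
  if (i < n)%N then sgb R (eps i) * (2 * x i k u) else x i k u - m i k.

Let by_ n eps i k : bmeas (y n eps i k).
Proof.
rewrite /y; case: (i < n)%N; first by apply: bmeasZ; exact: bmeasZ.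
by apply: bmeasB => //; exact: bmeas_cst.
Qed.

Let E n eps := \int[P]_w max_abs (fun k => \sum_i y n eps i k (U i w)).

Let byU n eps i k : bmeas (fun w => y n eps i k (U i w)).
Proof. exact: (bmeas_comp (by_ n eps i k) (mU i)). Qed.

Let B (n : 'I_N) eps k w := \sum_(i | i != n) y n eps i k (U i w).

Let bB n eps k : bmeas (B n eps k).
Proof. by apply: bmeas_sum => i; exact: byU. Qed.

Let decouple_coordinate (n : 'I_N) eps (g : K -> T -> R) : (forall k, bmeas (g k)) ->
  \int[P]_w max_abs (fun k => B n eps k w + g k (U n w)) =
  \int[P]_w \int[P]_w' max_abs (fun k => B n eps k w + g k (U n w')).
Proof.
move=> bg; pose J := [set i | i != n]%SET; pose J' := [set n]%SET.
have JJ' i : i \in J -> i \notin J' by rewrite !inE.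
pose F (s : sigma_of U J * sigma_of U J') :=
  max_abs (fun k => (\sum_(i | i != n) y n eps i k (U i s.1)) + g k (U n s.2)).
have mUs (L : {set 'I_N}) i : i \in L -> measurable_fun setT (U i : sigma_of U L -> T).
  exact: measurable_sigma_of.
have bF : bmeas F.
  apply: bmeas_max_abs => k; apply: bmeasD; last first.
    have b2 := bmeas_comp (bg k) (mUs J' n (finset.set11 n)).
    exact: (bmeas_comp b2 measurable_snd).
  have b1 : bmeas (fun s : sigma_of U J => \sum_(i | i != n) y n eps i k (U i s)).
    under eq_fun do rewrite big_mkcond.
    apply: bmeas_sum => i; case: (boolP (i == n)) => /= i_n; first exact: bmeas_cst.
    apply: (bmeas_comp (by_ n eps i k)).
    by apply: mUs; rewrite inE.
  exact: (bmeas_comp b1 measurable_fst).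
have := expect_decouple_family mU indepU JJ' bF.
by apply; move=> s; exact: max_abs_ge0.
Qed.

Let bmeas_double (n : 'I_N) eps (g : K -> T -> R) : (forall k, bmeas (g k)) ->
  bmeas (fun w => \int[P]_w' max_abs (fun k => B n eps k w + g k (U n w'))).
Proof.
move=> bg; pose F (s : Omega * Omega) :=
  max_abs (fun k => B n eps k s.1 + g k (U n s.2)).
have bF : bmeas F.
  apply: bmeas_max_abs => k; apply: bmeasD.
    exact: (bmeas_comp (bB n eps k) measurable_fst).
  exact: (bmeas_comp (bmeas_comp (bg k) (mU n)) measurable_snd).
by apply: (bmeas_partial_expectation P bF) => s; exact: max_abs_ge0.
Qed.

Let symmetrize_coordinate (n : 'I_N) eps :
  2 * \int[P]_w max_abs (fun k => B n eps k w + (X n k w - m n k)) <=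
  \int[P]_w max_abs (fun k => B n eps k w + 2 * X n k w) +
  \int[P]_w max_abs (fun k => B n eps k w - 2 * X n k w).
Proof.
pose g1 k u := x n k u - m n k; pose g2 k u := 2 * x n k u.
pose g3 k u := - (2 * x n k u).
have bg1 k : bmeas (g1 k) by apply: bmeasB => //; exact: bmeas_cst.
have bg2 k : bmeas (g2 k) by exact: bmeasZ.
have bg3 k : bmeas (g3 k) by apply: bmeasN; exact: bmeasZ.
rewrite (@decouple_coordinate n eps g1 bg1) (@decouple_coordinate n eps g2 bg2).
rewrite (@decouple_coordinate n eps g3 bg3).
rewrite -expectZ; last exact: bmeas_double.
rewrite -expectD; [|exact: bmeas_double|exact: bmeas_double].
apply: expect_le => [||w].
- by apply: bmeasZ; exact: bmeas_double.
- by apply: bmeasD; exact: bmeas_double.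
have bg (g : K -> T -> R) : (forall k, bmeas (g k)) ->
    bmeas (fun w' => max_abs (fun k => B n eps k w + g k (U n w'))).
  move=> bg'; apply: bmeas_max_abs => k; apply: bmeasD; first exact: bmeas_cst.
  exact: (bmeas_comp (bg' k) (mU n)).
set I3 := \int[P]_w' max_abs (fun k => B n eps k w + g3 k (U n w')).
(* Jensen: the mean may replace one of the two copies of the variable *)
have jensen k : `|B n eps k w - 2 * m n k| <= I3.
  have b3 : bmeas (fun w' => B n eps k w + g3 k (U n w')).
    by apply: bmeasD; [exact: bmeas_cst | exact: (bmeas_comp (bg3 k) (mU n))].
  have -> : B n eps k w - 2 * m n k = \int[P]_w' (B n eps k w + g3 k (U n w')).
    rewrite expectD; [|exact: bmeas_cst|exact: (bmeas_comp (bg3 k) (mU n))].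
    rewrite expect_cst; congr (_ + _).
    by rewrite /m -(expectZ P 2 (bX n k)) -(expectN P (bmeasZ 2 (bX n k))).
  apply: le_trans (expect_norm_le P b3) _.
  apply: expect_le => [||w']; [exact: bmeas_norm|exact: bg|].
  exact: (le_max_abs (fun k => B n eps k w + g3 k (U n w')) k).
have I30 : 0 <= I3 by apply: Rintegral_ge0 => w' _; exact: max_abs_ge0.
rewrite -expectZ; last exact: bg.
rewrite -[I3](expect_cst P) -expectD; [|exact: bg|exact: bmeas_cst].
apply: expect_le => [||w'].
- by apply: bmeasZ; exact: bg.
- by apply: bmeasD; [exact: bg|exact: bmeas_cst].
rewrite -ler_pdivlMl //; apply: max_abs_le => [|k].
  by rewrite mulr_ge0 // addr_ge0 // max_abs_ge0.
rewrite ler_pdivlMl //.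
have -> : 2 * `|B n eps k w + g1 k (U n w')| =
    `|(B n eps k w + g2 k (U n w')) + (B n eps k w - 2 * m n k)|.
  by rewrite -[X in X * _](@ger0_norm _ 2) // -normrM; congr `|_|; rewrite /g1 /g2; ring.
rewrite (le_trans (ler_normD _ _)) // lerD //.
exact: (le_max_abs (fun k => B n eps k w + g2 k (U n w')) k).
Qed.

(** A centred summand is replaced by a signed double summand, one coordinate at a
    time, by convexity and independence from the other coordinates. *)
Lemma symmetrization :
  \int[P]_w max_abs (fun k => \sum_i (x i k (U i w) - \int[P]_w' x i k (U i w'))) <=
  average_signs (fun eps =>
    \int[P]_w max_abs (fun k => \sum_i sgb R (eps i) * (2 * x i k (U i w)))).
Proof.
have step (n : 'I_N) : average_signs (E n) <= average_signs (E n.+1).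
  apply: (@average_signs_le_flip _ _ n) => eps.
  have yS (e : {ffun 'I_N -> bool}) i k u : i != n -> (forall l, l != n -> e l = eps l) ->
      y n.+1 e i k u = y n eps i k u.
    by move=> i_n eE; rewrite /y ltnS leq_eqVlt val_eqE (negbTE i_n) eE.
  have y0 (e : {ffun 'I_N -> bool}) i k u : i != n -> (forall l, l != n -> e l = eps l) ->
      y n e i k u = y n eps i k u.
    by move=> i_n eE; rewrite /y eE.
  have fl i : i != n -> flip n eps i = eps i by exact: flip_other.
  have En (e : {ffun 'I_N -> bool}) : (forall l, l != n -> e l = eps l) ->
      E n e = \int[P]_w max_abs (fun k => B n eps k w + (X n k w - m n k)).
    move=> eE; congr Rintegral; apply/funext => w; congr max_abs; apply/funext => k.
    rewrite (bigD1 n) //= addrC {2}/y ltnn; congr (_ + _).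
    by apply: eq_bigr => i i_n; exact: y0.
  have EnS (e : {ffun 'I_N -> bool}) : (forall l, l != n -> e l = eps l) ->
      E n.+1 e = \int[P]_w max_abs (fun k => B n eps k w + sgb R (e n) * (2 * X n k w)).
    move=> eE; congr Rintegral; apply/funext => w; congr max_abs; apply/funext => k.
    rewrite (bigD1 n) //= addrC {2}/y ltnSn; congr (_ + _).
    by apply: eq_bigr => i i_n; exact: yS.
  rewrite !En // !EnS // flip_at sgbN.
  have := symmetrize_coordinate n eps; rewrite mulr_natl mulr2n => /le_trans; apply.
  have E1 : \int[P]_w max_abs (fun k => B n eps k w + 1 * (2 * X n k w)) =
      \int[P]_w max_abs (fun k => B n eps k w + 2 * X n k w).
    by congr Rintegral; apply/funext => w; congr max_abs; apply/funext => k; rewrite mul1r.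
  have E2 : \int[P]_w max_abs (fun k => B n eps k w + (-1) * (2 * X n k w)) =
      \int[P]_w max_abs (fun k => B n eps k w - 2 * X n k w).
    by congr Rintegral; apply/funext => w; congr max_abs; apply/funext => k; rewrite mulN1r.
  by case: (eps n); rewrite /sgb /= ?expr0 ?expr1 ?opprK E1 E2 // addrC.
have chain n : (n <= N)%N -> average_signs (E 0) <= average_signs (E n).
  elim: n => // n IH nN; apply: le_trans (IH (ltnW nN)) _.
  exact: (step (Ordinal nN)).
have EN : E 0 [ffun=> true] <= average_signs (E N).
  by rewrite -(average_signs_cst N (E 0 [ffun=> true])); exact: chain (leqnn N).
apply: le_trans EN _; rewrite le_eqVlt; apply/orP; left; apply/eqP.
congr average_signs; apply/funext => eps; congr Rintegral; apply/funext => w.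
by congr max_abs; apply/funext => k; apply: eq_bigr => i _; rewrite /y ltn_ord.
Qed.

End symmetrization.

Section expected_maximum.
Context d dT (Omega : measurableType d) (T : measurableType dT) (R : realType)
  (P : probability Omega R) (N : nat) (U : 'I_N -> Omega -> T).
Hypothesis mU : forall i, measurable_fun setT (U i).
Hypothesis indepU : mutually_independent P U.
Context (K : finType) (k0 : K) (x : 'I_N -> K -> T -> R).
Hypothesis bx : forall i k, bmeas (x i k).
Hypothesis xk0 : forall i u, x i k0 u = 0.
Context (J : finType) (j0 : J) (a : 'I_N -> J -> Omega -> R) (b : K -> J -> R)
  (psi r : R).
Hypothesis ba : forall i j, bmeas (a i j).
Hypothesis bk0 : forall j, b k0 j = 0.
Hypothesis psi0 : 0 <= psi.
Hypothesis br : forall k, \sum_j `|b k j| <= r.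
Hypothesis x_lipschitz : {ae P, forall w, forall i k k',
  `|x i k (U i w) - x i k' (U i w)| <=
  psi * `|\sum_j b k j * a i j w - \sum_j b k' j * a i j w|}.

Lemma bmeas_sqrt (f : Omega -> R) : bmeas f -> bmeas (fun w => Num.sqrt (f w)).
Proof.
move=> [mf [M fM]]; split.
  have ms : measurable_fun setT (@Num.sqrt R).
    by apply: continuous_measurable_fun; exact: sqrt_continuous.
  exact: (measurableT_comp ms mf).
exists (Num.sqrt M) => w; rewrite ger0_norm ?sqrtr_ge0 //.
by rewrite ler_wsqrtr // (le_trans (ler_norm _)).
Qed.

(** After symmetrization and contraction the index k only enters through linear
    forms in the a i j, so the maximum over k costs no more than the one over j:
    only the logarithm of the size of J appears. *)
Lemma expect_max_deviation :
  \int[P]_w max_abs (fun k => \sum_i (x i k (U i w) - \int[P]_w' x i k (U i w'))) <=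
  4 * psi * r * Num.sqrt (2 * ln (2 * #|J|%:R)) *
  \int[P]_w Num.sqrt (\big[Order.max/0]_j \sum_i a i j w ^+ 2).
Proof.
have r0 : 0 <= r by apply: le_trans (br k0); exact: sumr_ge0.
apply: le_trans (symmetrization mU indepU bx) _.
have bxU i k : bmeas (fun w => x i k (U i w)) by exact: (bmeas_comp (bx i k) (mU i)).
have bS (eps : {ffun 'I_N -> bool}) :
    bmeas (fun w => max_abs (fun k => \sum_i sgb R (eps i) * (2 * x i k (U i w)))).
  apply: bmeas_max_abs => k; apply: bmeas_sum => i.
  by apply: bmeasZ; exact: bmeasZ.
have b2 : bmeas (fun w => Num.sqrt (\big[Order.max/0]_j \sum_i a i j w ^+ 2)).
  apply: bmeas_sqrt; apply: bmeas_bigmax => j; apply: bmeas_sum => i.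
  by under eq_fun do rewrite expr2; exact: bmeasM.
pose avg w := average_signs (fun eps : {ffun 'I_N -> bool} =>
  max_abs (fun k => \sum_i sgb R (eps i) * (2 * x i k (U i w)))).
have bavg : bmeas avg by apply: bmeasM; [exact: bmeas_sum | exact: bmeas_cst].
have -> : average_signs (fun eps : {ffun 'I_N -> bool} => \int[P]_w
    max_abs (fun k => \sum_i sgb R (eps i) * (2 * x i k (U i w)))) =
    \int[P]_w avg w.
  rewrite /average_signs -expect_sum // mulrC -expectZ; last exact: bmeas_sum.
  by congr Rintegral; apply/funext => w; rewrite mulrC.
rewrite -expectZ //; apply: expect_le_ae => //; first exact: bmeasZ.
apply: filterS x_lipschitz => w xlip; rewrite /avg.
pose t i k := \sum_j b k j * a i j w.
have psi20 : 0 <= 2 * psi by exact: mulr_ge0.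
have xk02 i : 2 * x i k0 (U i w) = 0 by rewrite xk0 mulr0.
have tk0 i : t i k0 = 0 by rewrite /t big1 // => j _; rewrite bk0 mul0r.
have xt i k k' : `|2 * x i k (U i w) - 2 * x i k' (U i w)| <= 2 * psi * `|t i k - t i k'|.
  by rewrite -mulrBr normrM ger0_norm // -mulrA ler_wpM2l.
apply: le_trans (rademacher_contraction psi20 xk02 tk0 xt) _.
have -> : 2 * (2 * psi) = 4 * psi by ring.
rewrite -!mulrA ler_wpM2l // ler_wpM2l //.
have tE eps : max_abs (fun k => \sum_i sgb R (eps i) * t i k) <=
    r * max_abs (fun j => \sum_i sgb R (eps i) * a i j w).
  apply: max_abs_le => [|k]; first by rewrite mulr_ge0 // max_abs_ge0.
  have -> : \sum_i sgb R (eps i) * t i k =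
      \sum_j b k j * \sum_i sgb R (eps i) * a i j w.
    under eq_bigr do rewrite mulr_sumr.
    rewrite exchange_big; apply: eq_bigr => j _.
    by rewrite mulr_sumr; apply: eq_bigr => i _; rewrite mulrCA.
  apply: le_trans (ler_norm_sum _ _ _) _.
  apply: le_trans (ler_wpM2r (max_abs_ge0 _) (br k)).
  rewrite mulr_suml; apply: ler_sum => j _; rewrite normrM ler_wpM2l //.
  exact: (le_max_abs (fun j => \sum_i sgb R (eps i) * a i j w) j).
apply: le_trans (average_signs_le tE) _.
rewrite average_signsZ ler_wpM2l // mulrC.
apply: (rademacher_max j0); first exact: sqrtr_ge0.
have sq0 : 0 <= \big[Order.max/0]_j \sum_i a i j w ^+ 2 by exact: bigmax_ge_id.
move=> j; rewrite sqr_sqrtr //.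
exact: (le_bigmax _ (fun j => \sum_i a i j w ^+ 2)).
Qed.

End expected_maximum.

(** * Taylor remainders *)

Section taylor.
Context (R : realType).

Lemma is_derive_affine_comp (G dG : R -> R) (x dl t : R) :
  is_derive (x + t * dl) 1 G (dG (x + t * dl)) ->
  is_derive t 1 (fun s : R => G (x + s * dl)) (dG (x + t * dl) * dl).
Proof.
move=> dGt; have aff : is_derive t 1 (fun s : R => x + s * dl) dl.
  by apply: is_derive_eq; rewrite /GRing.scale/=; ring.
exact: (@is_derive1_comp R G (fun s : R => x + s * dl) t _ _ dGt aff).
Qed.

Lemma mean_value_le (G dG : R -> R) (x dl F : R) :
  (forall t, 0 <= t <= 1 -> is_derive (x + t * dl) 1 G (dG (x + t * dl))) ->
  (forall t, 0 <= t <= 1 -> `|dG (x + t * dl)| <= F) ->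
  `|G (x + dl) - G x| <= F * `|dl|.
Proof.
move=> dGt Fb; pose k (t : R) := G (x + t * dl).
have kd (t : R) : 0 <= t <= 1 -> is_derive t 1 k (dG (x + t * dl) * dl).
  by move=> t01; apply: is_derive_affine_comp; exact: dGt.
have [t||t] := @MVT_segment R k (fun t => dG (x + t * dl) * dl) 0 1 ler01.
- by rewrite in_itv/= => /andP[t0 t1]; apply: kd; rewrite !ltW.
- apply: derivable_within_continuous => t; rewrite in_itv/= => t01.
  by have [] := kd t t01.
rewrite in_itv/= => t01; rewrite /k mul1r mul0r addr0 subr0 mulr1 => ->.
by rewrite normrM ler_wpM2r // Fb.
Qed.

(** Parametrizing the segment by t in [0, 1] covers both signs of dl. *)
Lemma taylor_le (G dG : R -> R) (x dl F : R) :
  (forall t, 0 <= t <= 1 -> is_derive (x + t * dl) 1 G (dG (x + t * dl))) ->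
  (forall t, 0 <= t <= 1 -> `|dG (x + t * dl) - dG x| <= F * `|t * dl|) ->
  G (x + dl) - G x - dG x * dl <= F / 2 * dl ^+ 2.
Proof.
move=> dGt Fb.
pose k (t : R) := G (x + t * dl) - t * (dG x * dl) - t ^+ 2 * (F / 2 * dl ^+ 2).
pose dk (t : R) := (dG (x + t * dl) - dG x) * dl - t * (F * dl ^+ 2).
have kd (t : R) : 0 <= t <= 1 -> is_derive t 1 k (dk t).
  move=> t01; have ? := is_derive_affine_comp (dGt t t01).
  rewrite /k; apply: is_derive_eq.
  by rewrite /dk /GRing.scale/=; field.
have [t||t] := @MVT_segment R k dk 0 1 ler01.
- by rewrite in_itv/= => /andP[t0 t1]; apply: kd; rewrite !ltW.
- apply: derivable_within_continuous => t; rewrite in_itv/= => t01.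
  by have [] := kd t t01.
rewrite in_itv/= => t01 kE.
have dk0 : dk t <= 0.
  rewrite subr_le0 (le_trans (ler_norm _)) // normrM.
  apply: le_trans (ler_wpM2r (normr_ge0 _) (Fb t t01)) _.
  move: t01 => /andP[t0 _].
  by rewrite normrM (ger0_norm t0) -!mulrA -normrM -expr2 ger0_norm ?sqr_ge0 // mulrCA.
move: kE; rewrite /k !mul1r !mul0r addr0 expr0n/= expr1n mul0r !subr0 mulr1.
by rewrite mul1r => kE; move: dk0; rewrite -kE; lra.
Qed.

Variables (a b : \bar R) (g : R -> R) (F1 F2 : R).
Hypothesis dg : forall t, inside a b t -> derivable g t 1.
Hypothesis gF1 : forall t, inside a b t -> `|derive1 g t| <= F1.
Hypothesis gF2 : forall t t', inside a b t -> inside a b t' ->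
  `|derive1 g t - derive1 g t'| <= F2 * `|t - t'|.

Lemma inside_segment x y t : inside a b x -> inside a b y -> 0 <= t <= 1 ->
  inside a b (x + t * (y - x)).
Proof.
wlog xy : x y t / x <= y => [hw|].
  have [xy|/ltW yx] := leP x y; first exact: hw.
  move=> ix iy /andP[t0 t1].
  have -> : x + t * (y - x) = y + (1 - t) * (x - y) by ring.
  by apply: hw => //; apply/andP; split; lra.
move=> [ax xb] [ay yb] /andP[t0 t1].
have xz : x <= x + t * (y - x) by rewrite lerDl mulr_ge0 // subr_ge0.
have zy : x + t * (y - x) <= y.
  have : (1 - t) * (y - x) >= 0 by rewrite mulr_ge0 // subr_ge0.
  by lra.
by split; [apply: lt_le_trans ax _; rewrite lee_fin
         | apply: le_lt_trans yb; rewrite lee_fin].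
Qed.

Let is_derive_g x : inside a b x -> is_derive x 1 g (derive1 g x).
Proof. by move=> ix; apply: DeriveDef; [exact: dg | rewrite derive1E]. Qed.

Lemma lipschitz_of_derive1 x y : inside a b x -> inside a b y ->
  `|g y - g x| <= F1 * `|y - x|.
Proof.
move=> ix iy; have -> : y = x + (y - x) by ring.
rewrite (_ : x + (y - x) - x = y - x); last by ring.
apply: (@mean_value_le g (derive1 g)) => t t01.
- exact: is_derive_g (inside_segment ix iy t01).
- exact: gF1 (inside_segment ix iy t01).
Qed.

Lemma taylor_remainder x y : inside a b x -> inside a b y ->
  `|g y - g x - derive1 g x * (y - x)| <= F2 / 2 * (y - x) ^+ 2.
Proof.
move=> ix iy; have yE : y = x + (y - x) by ring.
have lip t : 0 <= t <= 1 ->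
    `|derive1 g (x + t * (y - x)) - derive1 g x| <= F2 * `|t * (y - x)|.
  move=> t01; have := gF2 (inside_segment ix iy t01) ix.
  by congr (_ <= _ * `|_|); ring.
rewrite ler_norml; apply/andP; split.
  have H := @taylor_le (fun z => - g z) (fun z => - derive1 g z) x (y - x) F2.
  rewrite -yE in H.
  have {}H : - g y - - g x - - derive1 g x * (y - x) <= F2 / 2 * (y - x) ^+ 2.
    apply: H => t t01.
      have ? := is_derive_g (inside_segment ix iy t01).
      by apply: is_deriveN.
    by have := lip t t01; rewrite -normrN; congr (`|_| <= _); ring.
  by move: H; rewrite mulNr; lra.
have H := @taylor_le g (derive1 g) x (y - x) F2.
rewrite -yE in H; apply: H => t t01; last exact: lip.
exact: is_derive_g (inside_segment ix iy t01).
Qed.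

(** The value at x0 is the limit there when D is the derivative. *)
Definition slope_remainder (x0 D y : R) : R :=
  if y == x0 then 0 else (g y - g x0) / (y - x0) - D.

Lemma slope_remainderE x0 D y :
  g y - g x0 = (D + slope_remainder x0 D y) * (y - x0).
Proof.
rewrite /slope_remainder; case: eqVneq => [->|yx]; first by rewrite !subrr mulr0.
by rewrite addrCA subrr addr0 divfK // subr_eq0.
Qed.

Variable x0 : R.
Hypothesis ix0 : inside a b x0.

Let rem := slope_remainder x0 (derive1 g x0).

Lemma slope_remainder_le1 y : inside a b y -> `|rem y| <= 2 * F1.
Proof.
move=> iy; have F10 : 0 <= F1 by exact: le_trans (normr_ge0 _) (gF1 ix0).
rewrite /rem /slope_remainder; case: eqVneq => [_|yx].
  by rewrite normr0 mulr_ge0.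
rewrite (le_trans (ler_normB _ _)) // mulr_natl mulr2n lerD ?gF1 //.
rewrite normrM normfV ler_pdivrMr ?normr_gt0 ?subr_eq0 //.
exact: lipschitz_of_derive1.
Qed.

Lemma slope_remainder_le2 y : inside a b y -> `|rem y| <= F2 / 2 * `|y - x0|.
Proof.
move=> iy; rewrite /rem /slope_remainder; case: eqVneq => [->|yx].
  by rewrite subrr !normr0 mulr0.
have yx0 : y - x0 != 0 by rewrite subr_eq0.
rewrite (_ : _ - _ = (g y - g x0 - derive1 g x0 * (y - x0)) / (y - x0)); last first.
  by field.
rewrite normrM normfV ler_pdivrMr ?normr_gt0 // -[leRHS]mulrA -expr2.
rewrite real_normK ?num_real //.
exact: taylor_remainder.
Qed.

(** Both slopes are expanded at the point z lying between x0 and y; this keeps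
    the factor one half of the Taylor bound. *)
Let slope_remainder_lipschitz_same_side y z : inside a b y -> inside a b z ->
  0 < (z - x0) * (y - x0) -> `|z - x0| <= `|y - x0| ->
  `|rem y - rem z| <= F2 / 2 * `|y - z|.
Proof.
move=> iy iz; set u := z - x0; set t := y - x0 => ut0 le_ut.
have [u0 t0] : u != 0 /\ t != 0.
  by move: ut0; case: eqVneq => [->|_]; rewrite ?mul0r ?ltxx //;
     case: eqVneq => [->|_]; rewrite ?mulr0 ?ltxx.
have yzE : y - z = t - u by rewrite /t /u; ring.
pose r1 := g y - g z - derive1 g z * (y - z).
pose r2 := g x0 - g z - derive1 g z * (x0 - z).
have h1 : `|r1| <= F2 / 2 * (t - u) ^+ 2 by rewrite -yzE; exact: taylor_remainder.
have h2 : `|r2| <= F2 / 2 * u ^+ 2 by rewrite -sqrrN opprB; exact: taylor_remainder.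
have remE : rem y - rem z = (u * r1 + (t - u) * r2) / (u * t).
  rewrite /rem /slope_remainder -(subr_eq0 y) -(subr_eq0 z) (negbTE t0) (negbTE u0).
  have x0z : x0 - z = - u by rewrite /u; ring.
  rewrite /r1 /r2 x0z yzE -[y - x0]/t -[z - x0]/u.
  by field; rewrite u0 t0.
have sumE : `|t - u| + `|u| = `|t|.
  move: le_ut ut0; case: (ger0P u) => u1; case: (ger0P t) => t1 le_ut ut0.
  - by rewrite ger0_norm; lra.
  - by nra.
  - by nra.
  - by rewrite ler0_norm; lra.
rewrite remE normrM normfV ler_pdivrMr ?normr_gt0 ?mulf_neq0 // yzE.
apply: le_trans (ler_normD _ _) _; rewrite !normrM.
apply: le_trans (lerD (ler_wpM2l (normr_ge0 u) h1) (ler_wpM2l (normr_ge0 (t - u)) h2)) _.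
rewrite -(real_normK (num_real (t - u))) -(real_normK (num_real u)) -sumE.
by rewrite le_eqVlt; apply/orP; left; apply/eqP; ring.
Qed.

(** On opposite sides of x0 the bound of each remainder by its own increment is
    enough, because the increments add up. *)
Lemma slope_remainder_lipschitz y z : inside a b y -> inside a b z ->
  `|rem y - rem z| <= F2 / 2 * `|y - z|.
Proof.
move=> iy iz; have [same|opposite] := ltP 0 ((z - x0) * (y - x0)).
  have [le_zy|/ltW le_yz] := leP `|z - x0| `|y - x0|.
    exact: slope_remainder_lipschitz_same_side.
  rewrite distrC [in leRHS]distrC.
  by apply: slope_remainder_lipschitz_same_side => //; rewrite mulrC.
apply: le_trans (ler_normB _ _) _.
apply: le_trans (lerD (slope_remainder_le2 iy) (slope_remainder_le2 iz)) _.
rewrite -mulrDr; suff -> : `|y - x0| + `|z - x0| = `|y - z| by [].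
rewrite (_ : y - z = (y - x0) - (z - x0)); last by ring.
move: opposite; set u := z - x0; set t := y - x0 => tu.
case: (ger0P u) => u1; case: (ger0P t) => t1.
- have [t_eq0|u_eq0] : t = 0 \/ u = 0.
    have : u * t = 0 by apply/eqP; rewrite eq_le tu mulr_ge0.
    by move/eqP; rewrite mulf_eq0 => /orP[/eqP|/eqP]; [right|left].
  + by rewrite t_eq0 sub0r normrN ger0_norm // add0r.
  + by rewrite u_eq0 subr0 ger0_norm // addr0.
- by rewrite ler0_norm; lra.
- by rewrite ger0_norm; lra.
- by nra.
Qed.

End taylor.

Section difference_quotient.
Context (R : realType).

Definition difference_quotient (g : R -> R) (x : R) (n : nat) : R :=
  n.+1%:R * (g (x + n.+1%:R^-1) - g x).

(** This expresses the derivative by countably many values of g, hence measurably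
    in any parameter of g. *)
Lemma limn_esup_difference_quotient (g : R -> R) (x : R) : derivable g x 1 ->
  fine (limn_esup (EFin \o difference_quotient g x)) = derive1 g x.
Proof.
move=> dg.
have cv : difference_quotient g x n @[n --> \oo] --> derive1 g x.
  have : h^-1 *: (g (h + x) - g x) @[h --> 0^'] --> derive1 g x.
    rewrite /derive1; move: dg; rewrite /derivable.
    suff -> : (fun h : R => h^-1 *: ((g \o shift x) (h *: (1 : R)) - g x)) =
        (fun h => h^-1 *: (g (h + x) - g x)) by [].
    by apply/funext => h; rewrite /= [h%:A]mulr1.
  move=> /cvgr_dnbhsP/(_ (fun n => n.+1%:R^-1)) H.
  have {}H := H (conj (fun n => invr_neq0 (lt0r_neq0 (ltr0Sn R n))) cvg_harmonic).
  apply: cvg_trans H; apply: near_eq_cvg; apply: nearW => n.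
  by rewrite /difference_quotient /= invrK (addrC x).
have cvE : (EFin \o difference_quotient g x) @ \oo --> (derive1 g x)%:E.
  by apply: cvg_EFin => //; exact: nearW.
rewrite is_cvg_limn_esupE; first by rewrite (cvg_lim _ cvE).
by apply/cvg_ex; exists (derive1 g x)%:E.
Qed.

End difference_quotient.

(** * Countable suprema over the parameter domain *)

Section weighted_distance.
Context (R : realType) (p : nat) (dd : 'I_p -> R).
Hypothesis dd0 : forall j, 0 < dd j.
Implicit Types u v : 'rV[R]_p.

Lemma wdist_ge0 u v : 0 <= wdist dd u v.
Proof. by apply: sumr_ge0 => j _; rewrite mulr_ge0 // ltW. Qed.

Lemma wdistC u v : wdist dd u v = wdist dd v u.
Proof. by apply: eq_bigr => j _; rewrite distrC. Qed.

Lemma wdist_triangle w u v : wdist dd u v <= wdist dd u w + wdist dd w v.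
Proof.
rewrite -big_split /=; apply: ler_sum => j _.
by rewrite -mulrDr ler_wpM2l ?(ltW (dd0 j)) // ler_distD.
Qed.

(** One point of D is selected in each cube with rational centre and half-side
    1 / (k + 1) that meets D. *)
Lemma dense_sequence (D : set 'rV[R]_p) v0 : D v0 ->
  exists s : nat -> 'rV[R]_p, (forall n, D (s n)) /\
    forall v, D v -> forall e, 0 < e -> exists n, wdist dd v (s n) < e.
Proof.
move=> Dv0.
pose near (i : {ffun 'I_p -> rat} * nat) (v : 'rV[R]_p) :=
  D v /\ forall j, `|v 0 j - ratr (i.1 j)| < i.2.+1%:R^-1.
pose pick i := if pselect (exists v, near i v) is left h then sval (cid h) else v0.
have Dpick i : D (pick i).
  by rewrite /pick; case: pselect => // h; case: cid => v [].
exists (fun n => if unpickle n is Some i then pick i else v0); split.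
  by move=> n; case: unpickle.
move=> v Dv e e0; pose M := \sum_j dd j + 1.
have M0 : 0 < M by rewrite ltr_wpDl // sumr_ge0 // => j _; exact: ltW.
have [k ke] : exists k : nat, 2 * k.+1%:R^-1 < e / M.
  have eM : 0 < e / M / 2 by rewrite !divr_gt0.
  have /(_ _ eM) := @ltr_add_invr R 0.
  by move=> [k]; rewrite add0r => h; exists k; rewrite mulrC -ltr_pdivlMr.
have k_itv (a : R) : a - k.+1%:R^-1 < a + k.+1%:R^-1.
  by rewrite ltrBlDr -addrA ltrDl addr_gt0 // invr_gt0.
have rex j : exists q : rat, `|v 0 j - ratr q| < k.+1%:R^-1.
  have [q] := @rat_in_itvoo R (v 0 j - k.+1%:R^-1) (v 0 j + k.+1%:R^-1)
    (k_itv _).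
  by rewrite in_itv/= => /andP[q1 q2]; exists q; rewrite ltr_distl ltrBlDr q2 -ltrBlDr q1.
pose i : {ffun 'I_p -> rat} * nat := ([ffun j => sval (cid (rex j))], k).
have near_v : near i v.
  by split => // j; rewrite /= ffunE; case: cid.
exists (pickle i); rewrite pickleK /pick; case: pselect => [h|[]]; last by exists v.
case: cid => u [Du near_u] /=.
have close j : `|v 0 j - u 0 j| < e / M.
  apply: le_lt_trans ke; rewrite mulr_natl mulr2n.
  have := near_u j; have [_ /(_ j)] := near_v; rewrite /= => h1 h2.
  apply: le_trans (ler_distD (ratr (i.1 j)) _ _) _.
  by rewrite lerD // ?ltW // distrC.
apply: (@le_lt_trans _ _ (\sum_j dd j * (e / M))).
  by apply: ler_sum => j _; rewrite ler_wpM2l ?ltW.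
rewrite -mulr_suml mulrA ltr_pdivrMr // mulrC ltr_pM2l //.
by rewrite /M ltrDl.
Qed.

(** The supremum of the ratios only involves the values on a dense sequence,
    because the bound |K v| <= M * wdist v theta is closed in v. *)
Lemma ereal_sup_ratio_dense (D : set 'rV[R]_p) theta (s : nat -> 'rV[R]_p)
    (K : 'rV[R]_p -> R) (L : R) : D theta ->
  (forall n, D (s n)) ->
  (forall v, D v -> forall e, 0 < e -> exists n, wdist dd v (s n) < e) ->
  0 <= L -> K theta = 0 -> (forall u v, D u -> D v -> `|K u - K v| <= L * wdist dd u v) ->
  ereal_sup [set `|K v / wdist dd v theta|%:E | v in D] =
  ereal_sup (range (fun n => `|K (s n) / wdist dd (s n) theta|%:E)).
Proof.
move=> Dtheta Ds s_dense L0 Ktheta KL; apply/eqP; rewrite eq_le; apply/andP; split; last first.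
  by apply: ereal_sup_le => _ [n _ <-]; exists (s n).
set M := (X in (_ <= X)%E).
have geM n : (`|K (s n) / wdist dd (s n) theta|%:E <= M)%E.
  by apply: ereal_sup_ubound; exists n.
case: M geM => [M||] geM; last 2 first.
- exact: leey.
- by have := geM 0%N; rewrite leNgt ltNyr.
apply: ge_ereal_sup => _ [v Dv <-]; rewrite lee_fin.
have M0 : 0 <= M by have := geM 0%N; rewrite lee_fin; apply: le_trans.
have [vtheta|vtheta] := eqVneq (wdist dd v theta) 0.
  by rewrite vtheta invr0 mulr0 normr0.
have wv0 : 0 < wdist dd v theta by rewrite lt_def vtheta wdist_ge0.
have KsM n : `|K (s n)| <= M * wdist dd (s n) theta.
  have := geM n; rewrite lee_fin normrM normfV (ger0_norm (wdist_ge0 _ _)).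
  have [sn|sn] := eqVneq (wdist dd (s n) theta) 0; last first.
    by rewrite ler_pdivrMr // lt_def sn wdist_ge0.
  move=> _; rewrite sn mulr0.
  have -> : s n = theta.
    apply/rowP => j; apply/eqP; rewrite -subr_eq0 -normr_eq0.
    move/eqP: sn; rewrite psumr_eq0; last by move=> l _; rewrite mulr_ge0 // ltW.
    by move=> /allP/(_ j (mem_index_enum j))/=; rewrite mulf_eq0 gt_eqF //=.
  by rewrite Ktheta normr0.
rewrite normrM normfV (ger0_norm (ltW wv0)) ler_pdivrMr //.
apply/ler_addgt0Pr => e e0.
have ML0 : 0 < M + L + 1 by rewrite ltr_wpDl // addr_ge0.
have [n vn] := s_dense v Dv (e / (M + L + 1)) (divr_gt0 e0 ML0).
have vnE : (M + L) * wdist dd v (s n) <= e.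
  apply: le_trans (ler_wpM2l (addr_ge0 M0 L0) (ltW vn)) _.
  rewrite mulrCA ler_piMr ?(ltW e0) // ler_pdivrMr //; lra.
have tri := wdist_triangle v (s n) theta.
rewrite [wdist dd (s n) v]wdistC in tri.
have Kvn := KL v (s n) Dv (Ds n).
have Ktri : `|K v| <= `|K v - K (s n)| + `|K (s n)|.
  by rewrite -{1}[K v](subrK (K (s n))) ler_normD.
have h1 := KsM n; have h2 := ler_wpM2l M0 tri.
by lra.
Qed.

End weighted_distance.

Section probability_bounds.
Context d (Omega : measurableType d) (R : realType) (P : probability Omega R).

Lemma union_bound (J : finType) (A : J -> set Omega) (B : set Omega) (q : R) :
  (forall j, measurable (A j)) -> measurable B -> B `<=` \bigcup_j A j ->
  (forall j, P (A j) <= q%:E)%E -> (P B <= (#|J|%:R * q)%:E)%E.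
Proof.
move=> mA mB BA PA.
have big_bound (r : seq J) : measurable (\big[setU/set0]_(j <- r) A j) /\
    (P (\big[setU/set0]_(j <- r) A j) <= ((size r)%:R * q)%:E)%E.
  elim: r => [|j r [mr Pr]]; first by rewrite big_nil measure0 mul0r.
  rewrite big_cons; split; first exact: measurableU.
  apply: le_trans (measureU2 _ _ _) _ => //.
  by rewrite /= -addn1 natrD mulrDl mul1r EFinD addeC leeD.
have [mU PU] := big_bound (enum J).
rewrite cardE; apply: le_trans PU; apply: le_measure; rewrite ?inE //.
move=> w /BA[j _ Ajw]; rewrite -bigcup_seq; exists j => //.
by rewrite /= mem_enum.
Qed.

Lemma nondecreasing_bigcup_le (F : nat -> set Omega) (q : R) :
  (forall n, measurable (F n)) -> (forall m n, (m <= n)%N -> F m `<=` F n) ->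
  (forall n, P (F n) <= q%:E)%E -> (P (\bigcup_n F n) <= q%:E)%E.
Proof.
move=> mF ndF PF.
have mU : measurable (\bigcup_n F n) by exact: bigcup_measurable.
have cvF : P \o F @ \oo --> P (\bigcup_n F n).
  by apply: nondecreasing_cvg_mu => // m n mn; apply/subsetPset; exact: ndF.
rewrite -(cvg_lim _ cvF) //; apply: lime_le; first by apply/cvg_ex; eexists; exact: cvF.
exact: nearW.
Qed.

Lemma measurable_ereal_sup_seq (X : nat -> Omega -> R) :
  (forall n, measurable_fun setT (X n)) ->
  measurable_fun setT (fun w => ereal_sup (range (fun n => (X n w)%:E))).
Proof.
move=> mX; have := @measurable_fun_esups _ Omega R setT (fun n w => (X n w)%:E).
move=> /(_ _ 0%N) H.
apply: (eq_measurable_fun _ _ (H _)) => [w _|n]; last exact/measurable_EFinP.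
rewrite /esups /sdrop /=; congr ereal_sup.
by apply/seteqP; split => [_ [n _ <-]|_ [n _ <-]]; exists n.
Qed.

(** Tail bounds for finite maxima pass to the supremum of a sequence; the slack
    e makes room for the strict inequality in the limit. *)
Lemma tail_ereal_sup_seq (X : nat -> Omega -> R) (c q : R) :
  (forall n, measurable_fun setT (X n)) ->
  (forall m (e : R), (0 < e)%R ->
    P (\bigcup_(n in `I_m) [set w | (c + e < X n w)%R]) <= q%:E)%E ->
  (P [set w | c%:E < ereal_sup (range (fun n => (X n w)%:E))] <= q%:E)%E.
Proof.
move=> mX Pq.
pose F m := \bigcup_(n in `I_m) [set w | (c + m.+1%:R^-1 < X n w)%R].
have -> : [set w | c%:E < ereal_sup (range (fun n => (X n w)%:E))]%E =
    \bigcup_m F m.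
  apply/seteqP; split => [w /= /ereal_sup_gt[_ [n _ <-]]|w [m _ [n _ /= cX]]].
    rewrite lte_fin => cX.
    have [k ck] := ltr_add_invr cX.
    exists (maxn n.+1 k) => //; exists n; first by rewrite /= leq_max leqnn.
    apply: le_lt_trans ck; rewrite lerD2l lef_pV2 ?posrE // ler_nat ltnS.
    exact: leq_maxr.
  apply: (@lt_le_trans _ _ (X n w)%:E).
    by rewrite lte_fin (le_lt_trans _ cX) // lerDl invr_ge0.
  by apply: ereal_sup_ubound; exists n.
apply: nondecreasing_bigcup_le => [m|m n mn w [k km /= cX]|m].
- by apply: bigcup_measurable => n _; exact: measurable_superlevel.
- exists k; first exact: leq_trans mn.
  by apply: le_lt_trans cX; rewrite lerD2l lef_pV2 ?posrE // ler_nat.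
- by apply: Pq; rewrite invr_gt0.
Qed.

End probability_bounds.

Lemma measurable_invr (R : realType) : measurable_fun setT (fun x : R => x^-1).
Proof.
rewrite -(setUv [set 0%R]); apply/measurable_funU => //; first exact: measurableC.
split; first exact: measurable_fun_set1.
apply: open_continuous_measurable_fun.
  by rewrite openC; exact: closed_eq.
by move=> x; rewrite inE /= => /eqP x0; exact: inv_continuous.
Qed.

Section clipping.
Context (R : realType).

(** Truncation turns almost sure bounds into pointwise ones. *)
Definition clip (M r : R) : R := Num.max (- M) (Num.min M r).

Lemma normr_clip_le M r : 0 <= M -> `|clip M r| <= M.
Proof.
move=> M0; rewrite /clip ler_norml le_max lexx /= ge_max ge_min lexx /= andbT.
by rewrite (le_trans _ M0) // oppr_le0.
Qed.

Lemma clip_id M r : `|r| <= M -> clip M r = r.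
Proof.
rewrite ler_norml => /andP[r1 r2]; rewrite /clip.
by rewrite (min_idPr r2) (max_idPr r1).
Qed.

Lemma bmeas_clip d (T : measurableType d) (f : T -> R) (M : R) : 0 <= M ->
  measurable_fun setT f -> bmeas (fun x => clip M (f x)).
Proof.
move=> M0 mf; split; last by exists M => x; exact: normr_clip_le.
apply: measurable_maxr; first exact: measurable_cst.
by apply: measurable_minr => //; exact: measurable_cst.
Qed.

End clipping.

(** * Linearization of the centred sums *)

Lemma measurable_bigmax d (T : measurableType d) (R : realType) (I : Type)
    (r : seq I) (f : I -> T -> R) : (forall i, measurable_fun setT (f i)) ->
  measurable_fun setT (fun x => \big[Order.max/0]_(i <- r) f i x).
Proof.
move=> mf; elim: r => [|i r IH].
  by under eq_fun do rewrite big_nil; exact: measurable_cst.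
by under eq_fun do rewrite big_cons; exact: measurable_maxr.
Qed.

Lemma normr_expect_le_ae d (T : measurableType d) (R : realType)
    (P : probability T R) (f : T -> R) (c : R) : 0 <= c ->
  measurable_fun setT f -> {ae P, forall x, `|f x| <= c} -> `|\int[P]_x f x| <= c.
Proof.
move=> c0 mf fc; have bf := bmeas_clip c0 mf.
have -> : \int[P]_x f x = \int[P]_x clip c (f x).
  congr fine; apply: ae_eq_integral => //.
  - exact/measurable_EFinP.
  - by apply/measurable_EFinP; case: bf.
  - by apply: filterS fc => x fxc _; rewrite clip_id.
apply: le_trans (expect_norm_le P bf) _; rewrite -[leRHS](expect_cst P).
apply: expect_le; [exact: bmeas_norm | exact: bmeas_cst | move=> x].
exact: normr_clip_le.
Qed.

Section setting.
Context (d dY dZ : measure_display) (Omega : measurableType d)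
  (TY : measurableType dY) (TZ : measurableType dZ) (R : realType)
  (P : probability Omega R) (N p : nat)
  (Y : 'I_N -> {RV P >-> TY}) (Z : 'I_N -> {RV P >-> TZ})
  (gamma : 'I_N -> R -> TY -> R) (h : TZ -> 'rV[R]_p) (D0 : set 'rV[R]_p)
  (a b : 'I_N -> \bar R) (F1 F2 : R) (dd : 'I_p -> R).
Hypothesis N_gt0 : (0 < N)%N.
Hypothesis p_gt0 : (0 < p)%N.
Hypothesis indep : mutually_independent P (fun i w => (Y i w, Z i w)).
Hypothesis mgamma : forall i,
  measurable_fun setT (fun ty : R * TY => gamma i ty.1 ty.2).
Hypothesis mh : forall j : 'I_p, measurable_fun setT (fun z => h z 0 j).
Hypothesis intgamma : forall i v, D0 v ->
  P.-integrable setT (EFin \o (fun w => gamma i (dotp (h (Z i w)) v) (Y i w))).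
Hypothesis hreg : regularity P Y gamma a b F1 F2.
Hypothesis hbnd : boundedness P Z h dd.
Hypothesis hdom : parameter_domain P Z h D0 a b.
Variable theta : 'rV[R]_p.
Hypothesis D0theta : D0 theta.

Let U i w := (Y i w, Z i w).

Let mU i : measurable_fun setT (U i).
Proof. by apply: measurable_fun_pair; exact: measurable_funPT. Qed.

Let dd0 : forall j, 0 < dd j := hbnd.1.

Let good (w : Omega) : Prop := [/\ forall i,
  let g := fun t : R => gamma i t (Y i w) in
    [/\ forall t, inside (a i) (b i) t -> derivable g t 1,
        forall t, inside (a i) (b i) t -> `|derive1 g t| <= F1 &
        forall t t', inside (a i) (b i) t -> inside (a i) (b i) t' ->
          `|derive1 g t - derive1 g t'| <= F2 * `|t - t'|],
  forall (j : 'I_p) (i : 'I_N), `|h (Z i w) 0 j| <= dd j &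
  forall (v : 'rV[R]_p) (i : 'I_N), D0 v ->
    inside (a i) (b i) (dotp (h (Z i w)) v)].

Let ae_good : {ae P, forall w, good w}.
Proof.
have [_ hr] := hreg; have [_ hb] := hbnd.
by apply: filterS3 hr hb hdom => w *; split.
Qed.

Let exists_good : exists w, good w.
Proof.
have [B [mB PB0 subB]] := ae_good.
apply: contrapT => no_good.
have BT : B = setT.
  by apply/seteqP; split => // w _; apply: subB => /= gw; apply: no_good; exists w.
by move: PB0; rewrite BT probability_setT => /eqP; rewrite onee_eq0.
Qed.

Let i0 : 'I_N := Ordinal N_gt0.

Let F1_ge0 : 0 <= F1.
Proof.
have [w [gw _ hD]] := exists_good; have [_ gF1 _] := gw i0.
exact: le_trans (normr_ge0 _) (gF1 _ (hD theta i0 D0theta)).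
Qed.

Let F2_ge0 : 0 <= F2.
Proof.
have [w [gw _ hD]] := exists_good; have [_ _ gF2] := gw i0.
have [ax xb] := hD theta i0 D0theta; set x := dotp _ _ in ax xb.
have [y xy yb] : exists2 y, x < y & (y%:E < b i0)%E.
  case: (b i0) xb => [r|_|//].
    by rewrite lte_fin => xr; exists ((x + r) / 2); rewrite ?lte_fin; lra.
  by exists (x + 1); rewrite ?ltey // ltrDl.
have ay : (a i0 < y%:E)%E by apply: lt_trans ax _; rewrite lte_fin.
have := le_trans (normr_ge0 _) (gF2 y x (conj ay yb) (conj ax xb)).
by rewrite pmulr_lge0 // normr_gt0 subr_eq0 gt_eqF.
Qed.

Let dotp_sub (x u v : 'rV[R]_p) :
  dotp x u - dotp x v = \sum_j x 0 j * (u 0 j - v 0 j).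
Proof. by rewrite -sumrB; apply: eq_bigr => j _; rewrite mulrBr. Qed.

Let normr_dotp_sub w i u v : good w ->
  `|dotp (h (Z i w)) u - dotp (h (Z i w)) v| <= wdist dd u v.
Proof.
move=> [_ hb _]; rewrite dotp_sub; apply: le_trans (ler_norm_sum _ _ _) _.
by apply: ler_sum => j _; rewrite normrM ler_wpM2r // hb.
Qed.

Let cc (j : 'I_p) (u : TY * TZ) : R := clip 1 (h u.2 0 j / dd j).

(** A version of the derivative at h^T theta that is defined and measurable for
    every observation; it is the derivative almost surely. *)
Let gp i (u : TY * TZ) : R := clip F1 (fine (limn_esup (fun n =>
  (difference_quotient (fun t => gamma i t u.1) (dotp (h u.2) theta) n)%:E))).

Let sr i v (u : TY * TZ) : R := slope_remainder (fun t => gamma i t u.1)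
  (dotp (h u.2) theta) (gp i u) (dotp (h u.2) v).

Let phi v : R := Num.min (2 * F1) (F2 * wdist dd v theta / 2).

Let x1 i j (u : TY * TZ) : R := cc j u * gp i u.
Let xf i j v (u : TY * TZ) : R := cc j u * clip (phi v) (sr i v u).

Let phi_ge0 v : 0 <= phi v.
Proof.
by rewrite le_min mulr_ge0 //= divr_ge0 // mulr_ge0 // wdist_ge0.
Qed.

Let bcc j : bmeas (cc j).
Proof.
apply: bmeas_clip => //; apply: measurable_funM; last exact: measurable_cst.
exact: (measurableT_comp (mh j) measurable_snd).
Qed.

Let mdotp v : measurable_fun setT (fun u : TY * TZ => dotp (h u.2) v).
Proof.
apply: measurable_sum => j; apply: measurable_funM; last exact: measurable_cst.
exact: (measurableT_comp (mh j) measurable_snd).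
Qed.

Let mgamma_comp i (f : TY * TZ -> R) : measurable_fun setT f ->
  measurable_fun setT (fun u : TY * TZ => gamma i (f u) u.1).
Proof.
move=> mf.
exact: (measurableT_comp (mgamma i) (measurable_fun_pair mf measurable_fst)).
Qed.

Let bgp i : bmeas (gp i).
Proof.
apply: bmeas_clip => //.
apply: (measurableT_comp (fine_measurable measurableT)).
apply: measurable_fun_limn_esup => n; apply/measurable_EFinP.
apply: measurable_funM; first exact: measurable_cst.
apply: measurable_funB; apply: mgamma_comp => //.
by apply: measurable_funD => //; exact: measurable_cst.
Qed.

Let msr i v : measurable_fun setT (sr i v).
Proof.
rewrite /sr /slope_remainder.
have mdiv (f : TY * TZ -> R) : measurable_fun setT f ->
    measurable_fun setT (fun u => (f u)^-1).
  by move=> mf; exact: (measurableT_comp (@measurable_invr R) mf).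
apply: measurable_fun_ifT.
- by apply: measurable_fun_eqr.
- exact: measurable_cst.
- apply: measurable_funB; last by have [] := bgp i.
  apply: measurable_funM; first by apply: measurable_funB; exact: mgamma_comp.
  by apply: mdiv; exact: measurable_funB.
Qed.

Let bx1 i j : bmeas (x1 i j). Proof. exact: bmeasM. Qed.

Let bxf i j v : bmeas (xf i j v).
Proof. by apply: bmeasM => //; apply: bmeas_clip. Qed.

Let ccE w i j : good w -> cc j (U i w) = h (Z i w) 0 j / dd j.
Proof.
move=> [_ hb _]; rewrite /cc clip_id //= normrM normfV (gtr0_norm (dd0 j)).
by rewrite ler_pdivrMr // mul1r hb.
Qed.

Let gpE w i : good w ->
  gp i (U i w) = derive1 (fun t => gamma i t (Y i w)) (dotp (h (Z i w)) theta).
Proof.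
move=> [gw _ hD]; have [dg gF1 _] := gw i; have ix0 := hD theta i D0theta.
have := limn_esup_difference_quotient (dg _ ix0); rewrite /gp /comp /= => ->.
by rewrite clip_id // gF1.
Qed.

Let normr_sr_le w i v : good w -> D0 v -> `|sr i v (U i w)| <= phi v.
Proof.
move=> gw Dv; have [reg _ hD] := gw; have [dg gF1 gF2] := reg i.
have ix0 := hD theta i D0theta; have iv := hD v i Dv.
rewrite /sr (gpE i gw) le_min (slope_remainder_le1 dg gF1 ix0 iv) /=.
apply: le_trans (slope_remainder_le2 dg gF2 ix0 iv) _.
rewrite mulrAC ler_wpM2r ?invr_ge0 // ler_wpM2l //.
exact: normr_dotp_sub.
Qed.

Let xfE w i j v : good w -> D0 v ->
  xf i j v (U i w) = h (Z i w) 0 j / dd j * sr i v (U i w).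
Proof. by move=> gw Dv; rewrite /xf ccE // clip_id // normr_sr_le. Qed.

Let xf_theta i j u : xf i j theta u = 0.
Proof.
rewrite /xf /sr /slope_remainder eqxx clip_id ?mulr0 // normr0 //.
Qed.

Let keff (v : 'rV[R]_p) (j : 'I_p) : R := dd j * (v 0 j - theta 0 j).

Let dotp_sub_theta w i v : good w ->
  dotp (h (Z i w)) v - dotp (h (Z i w)) theta = \sum_j keff v j * cc j (U i w).
Proof.
move=> gw; rewrite dotp_sub; apply: eq_bigr => j _; rewrite (ccE i j gw) /keff.
by field; rewrite gt_eqF.
Qed.

Let sum_keff v : \sum_j `|keff v j| = wdist dd v theta.
Proof. by apply: eq_bigr => j _; rewrite normrM gtr0_norm. Qed.

Let increment w i v : good w -> D0 v ->
  gamma i (dotp (h (Z i w)) v) (Y i w) - gamma i (dotp (h (Z i w)) theta) (Y i w) =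
  \sum_j keff v j * (x1 i j (U i w) + xf i j v (U i w)).
Proof.
move=> gw Dv.
rewrite (slope_remainderE (fun t => gamma i t (Y i w)) _ (gp i (U i w))).
rewrite (dotp_sub_theta i v gw) mulr_sumr; apply: eq_bigr => j _.
by rewrite (xfE i j gw Dv) -(ccE i j gw) -/(sr i v (U i w)) /x1; ring.
Qed.

Let bU (f : TY * TZ -> R) i : bmeas f -> bmeas (fun w => f (U i w)).
Proof. by move=> bf; exact: (bmeas_comp bf (mU i)). Qed.

Let W j v w : R := \sum_i (xf i j v (U i w) - \int[P]_w' xf i j v (U i w')).
Let T j w : R := \sum_i (x1 i j (U i w) - \int[P]_w' x1 i j (U i w')).

Let bW j v : bmeas (W j v).
Proof.
by apply: bmeas_sum => i; apply: bmeasB; [exact: bU | exact: bmeas_cst].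
Qed.

Let bT j : bmeas (T j).
Proof.
by apply: bmeas_sum => i; apply: bmeasB; [exact: bU | exact: bmeas_cst].
Qed.

Let S := fun (v : 'rV[R]_p) (w : Omega) => \sum_(i < N)
  centered P (fun w' => gamma i (dotp (h (Z i w')) v) (Y i w')) w.

Let SE v w : S v w = \sum_i (gamma i (dotp (h (Z i w)) v) (Y i w) -
  \int[P]_w' gamma i (dotp (h (Z i w')) v) (Y i w')).
Proof. by apply: eq_bigr => i _; rewrite /centered unlock. Qed.

Let decomposition w v : good w -> D0 v ->
  S v w = S theta w + \sum_j keff v j * (T j w + W j v w).
Proof.
move=> gw Dv; apply/eqP; rewrite addrC -subr_eq; apply/eqP.
rewrite !SE -sumrB.
pose m1 i j := \int[P]_w' x1 i j (U i w'); pose mf i j := \int[P]_w' xf i j v (U i w').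
have mean i : \int[P]_w' gamma i (dotp (h (Z i w')) v) (Y i w') -
    \int[P]_w' gamma i (dotp (h (Z i w')) theta) (Y i w') =
    \sum_j keff v j * (m1 i j + mf i j).
  rewrite -RintegralB //; [|exact: intgamma|exact: intgamma].
  have bsum (j : 'I_p) : bmeas (fun w' => keff v j * (x1 i j (U i w') + xf i j v (U i w'))).
    by apply: bmeasZ; apply: bmeasD; exact: bU.
  transitivity (\int[P]_w' \sum_j keff v j * (x1 i j (U i w') + xf i j v (U i w'))).
    congr fine; apply: ae_eq_integral => //.
    - have := integrableB measurableT (intgamma i Dv) (intgamma i D0theta).
      exact: measurable_int.
    - by apply/measurable_EFinP; have [] := bmeas_sum (index_enum 'I_p) xpredT bsum.
    - by apply: filterS ae_good => w' gw' _; rewrite increment.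
  rewrite expect_sum //; apply: eq_bigr => j _.
  by rewrite expectZ ?expectD //; [exact: bU|exact: bU|apply: bmeasD; exact: bU].
have term i : gamma i (dotp (h (Z i w)) v) (Y i w) -
    \int[P]_w' gamma i (dotp (h (Z i w')) v) (Y i w') -
    (gamma i (dotp (h (Z i w)) theta) (Y i w) -
    \int[P]_w' gamma i (dotp (h (Z i w')) theta) (Y i w')) =
    \sum_j keff v j * ((x1 i j (U i w) - m1 i j) + (xf i j v (U i w) - mf i j)).
  have swap (A B C D : R) : A - B - (C - D) = (A - C) - (B - D) by ring.
  rewrite swap mean increment // -sumrB; apply: eq_bigr => j _.
  by ring.
rewrite (eq_bigr _ (fun i _ => term i)).
rewrite exchange_big; apply: eq_bigr => j _.
by rewrite /T /W -big_split /= mulr_sumr.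
Qed.

Let keff_ratio_le v (c : 'I_p -> R) :
  `|(\sum_j keff v j * c j) / wdist dd v theta| <= max_abs c.
Proof.
have [->|wv] := eqVneq (wdist dd v theta) 0.
  by rewrite invr0 mulr0 normr0 max_abs_ge0.
have wv0 : 0 < wdist dd v theta by rewrite lt_def wv wdist_ge0.
rewrite normrM normfV (gtr0_norm wv0) ler_pdivrMr //.
apply: le_trans (ler_norm_sum _ _ _) _.
rewrite -sum_keff mulr_sumr; apply: ler_sum => j _.
by rewrite normrM mulrC ler_wpM2r // le_max_abs.
Qed.

Let mx w : R := \big[Order.max/0]_j \sum_i cc j (U i w) ^+ 2.

Let bmx : bmeas mx.
Proof.
apply: bmeas_bigmax => j; apply: bmeas_sum => i.
by under eq_fun do rewrite expr2; apply: bmeasM; exact: bU.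
Qed.

Let mx_ge0 w : 0 <= mx w. Proof. exact: bigmax_ge_id. Qed.

Let Em := \int[P]_w mx w.
Let Es := \int[P]_w Num.sqrt (mx w).

Let Em_ge0 : 0 <= Em. Proof. by apply: Rintegral_ge0 => w _. Qed.

Let Es_ge0 : 0 <= Es.
Proof. by apply: Rintegral_ge0 => w _; exact: sqrtr_ge0. Qed.

(** Bernstein's inequality around the mean is combined with the bound of the mean.
    The slack e keeps the variance proxy positive. *)
Let finite_tail (j : 'I_p) m (vs : 'I_m.+1 -> 'rV[R]_p) (r x e : R) :
  let phr := Num.min (2 * F1) (F2 * r / 2) in
  vs ord0 = theta -> (forall k, D0 (vs k)) -> 
  (forall k, wdist dd (vs k) theta <= r) -> 0 < x -> 0 < e ->
  (P [set w | (2 * F2 * r * Num.sqrt (2 * ln (2 * p%:R)) * Es +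
     phr * Num.sqrt Em * Num.sqrt (2 * x) + 2 * phr * x + e <
     max_abs (fun k => W j (vs k) w))%R] <= (expR (- x))%:E)%E.
Proof.
move=> phr vs0 Dvs vsr x0 e0.
have r0 : 0 <= r by apply: le_trans (vsr ord0); exact: wdist_ge0.
have phr0 : 0 <= phr by rewrite le_min mulr_ge0 //= divr_ge0 // mulr_ge0.
have phi_phr k : phi (vs k) <= phr.
  by rewrite /phi /phr le_min2 // ler_wpM2r ?invr_ge0 // ler_wpM2l.
pose x_ i k u := xf i j (vs k) u.
have bx_ i k : bmeas (x_ i k) by exact: bxf.
pose m_ k := \sum_i \int[P]_w x_ i k (U i w).
pose Zm w := max_abs (fun k => \sum_i x_ i k (U i w) - m_ k).
have ZmE w : max_abs (fun k => W j (vs k) w) = Zm w.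
  by congr max_abs; apply/funext => k; rewrite /W sumrB.
have bZm : bmeas Zm.
  apply: bmeas_max_abs => k; apply: bmeasB; last exact: bmeas_cst.
  by apply: bmeas_sum => i; exact: bU.
pose c (i : 'I_N) u := `|cc j u|.
have bc i : bmeas (c i) by exact: bmeas_norm.
have c01 i u : 0 <= c i u <= 1 by rewrite normr_ge0 /= /c normr_clip_le.
have xc i k u : `|x_ i k u| <= phr * c i u.
  rewrite /x_ /xf normrM mulrC ler_wpM2r //.
  exact: le_trans (normr_clip_le _ (phi_ge0 _)) (phi_phr k).
have psi0 : 0 <= F2 / 2 by rewrite divr_ge0.
have EZm : \int[P]_w Zm w <= 2 * F2 * r * Num.sqrt (2 * ln (2 * p%:R)) * Es.
  have xk0 i u : x_ i ord0 u = 0 by rewrite /x_ vs0 xf_theta.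
  pose a_ (i : 'I_N) (j' : 'I_p) w := cc j' (U i w).
  have ba i j' : bmeas (a_ i j') by exact: bU.
  have bk0 j' : keff (vs ord0) j' = 0 by rewrite /keff vs0 subrr mulr0.
  have br k : \sum_j' `|keff (vs k) j'| <= r by rewrite sum_keff.
  have xlip : {ae P, forall w, forall i k k',
      `|x_ i k (U i w) - x_ i k' (U i w)| <= F2 / 2 *
      `|\sum_j' keff (vs k) j' * a_ i j' w - \sum_j' keff (vs k') j' * a_ i j' w|}.
    apply: filterS ae_good => w gw i k k'.
    rewrite -!dotp_sub_theta // opprB addrA subrK /x_ !xfE // -mulrBr normrM.
    have [reg _ hD] := gw; have [dg gF1 gF2] := reg i.
    have := slope_remainder_lipschitz dg gF2 (hD theta i D0theta)
      (hD (vs k) i (Dvs k)) (hD (vs k') i (Dvs k')).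
    rewrite -(gpE i gw) -!/(sr i _ (U i w)); apply: le_trans.
    rewrite ler_piMl // -(ccE i j gw); exact: normr_clip_le.
  have := @expect_max_deviation _ _ _ _ _ P N U mU indep _ ord0 x_ bx_ xk0 _ j a_
    (fun k => keff (vs k)) (F2 / 2) r ba bk0 psi0 br xlip.
  rewrite card_ord [X in _ <= _ * X](_ : _ = Es) // => H.
  rewrite [leLHS](_ : _ = \int[P]_w max_abs (fun k => \sum_i
    (x_ i k (U i w) - \int[P]_w' x_ i k (U i w')))).
    apply: le_trans H _; rewrite le_eqVlt; apply/orP; left; apply/eqP.
    by field.
  congr Rintegral; apply/funext => w; congr max_abs; apply/funext => k.
  by rewrite sumrB.
pose v := phr ^+ 2 * Em + e ^+ 2 / (2 * x).
have v0 : 0 < v.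
  by rewrite ltr_wpDl ?mulr_ge0 ?sqr_ge0 // divr_gt0 ?exprn_gt0 // mulr_gt0.
have cEm : phr ^+ 2 * \sum_i \int[P]_w c i (U i w) ^+ 2 <= v.
  apply: ler_wpDr; first by rewrite divr_ge0 ?sqr_ge0 // mulr_ge0 // ltW.
  rewrite ler_wpM2l ?sqr_ge0 //.
  have bc2 i : bmeas (fun w => c i (U i w) ^+ 2).
    by under eq_fun do rewrite expr2; apply: bmeasM; exact: bU.
  rewrite -expect_sum //; apply: expect_le => //; first exact: bmeas_sum.
  move=> w; apply: le_trans (_ : \sum_i cc j (U i w) ^+ 2 <= _).
    by apply: ler_sum => i _; rewrite /c real_normK ?num_real.
  exact: (le_bigmax _ (fun j => \sum_i cc j (U i w) ^+ 2)).
have mgf lam : 0 <= lam -> lam * (2 * phr) < 1 ->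
    \int[P]_w expR (lam * Zm w) <= expR (lam * \int[P]_w Zm w +
      lam ^+ 2 / 2 / (1 - lam * (2 * phr)) * v).
  move=> lam0 lamphr.
  have := @mgf_max_deviation _ _ _ _ _ P N U mU indep _ x_ c phr m_ bx_ bc c01
    phr0 xc lam lam0 lamphr.
  move=> /le_trans; apply; rewrite ler_expR lerD2l ler_wpM2l //.
  by rewrite divr_ge0 ?divr_ge0 ?sqr_ge0 // subr_ge0 ltW.
have phr20 : 0 <= 2 * phr by exact: mulr_ge0.
apply: le_trans (bernstein_tail bZm v0 phr20 (ltW x0) mgf).
apply: le_measure; rewrite ?inE.
  by apply: measurable_superlevel; have [] := bmeas_max_abs (fun k => bW j (vs k)).
  by apply: measurable_superlevel; case: bZm.
move=> w /=; rewrite ZmE; apply: le_lt_trans.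
have sqrtD : Num.sqrt (2 * v * x) <= phr * Num.sqrt Em * Num.sqrt (2 * x) + e.
  have rhs0 : 0 <= phr * Num.sqrt Em * Num.sqrt (2 * x).
    by rewrite !mulr_ge0 // sqrtr_ge0.
  rewrite -[leRHS]ger0_norm; last by rewrite addr_ge0 // ltW.
  rewrite -sqrtr_sqr ler_sqrt ?sqr_ge0 // sqrrD !exprMn !sqr_sqrtr ?(ltW x0) //; last first.
    by rewrite mulr_ge0 // ltW.
  have -> : 2 * v * x = phr ^+ 2 * Em * (2 * x) + e ^+ 2.
    by rewrite /v; field; rewrite gt_eqF.
  by rewrite lerD2r lerDl mulrn_wge0 // mulr_ge0 // ltW.
by lra.
Qed.

Let S_lipschitz w u v : good w -> D0 u -> D0 v ->
  `|S u w - S v w| <= N%:R * (2 * F1) * wdist dd u v.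
Proof.
move=> gw Du Dv.
have lip i w' : good w' -> `|gamma i (dotp (h (Z i w')) u) (Y i w') -
    gamma i (dotp (h (Z i w')) v) (Y i w')| <= F1 * wdist dd u v.
  move=> gw'; have [reg _ hD] := gw'; have [dg gF1 _] := reg i.
  apply: le_trans (lipschitz_of_derive1 dg gF1 (hD v i Dv) (hD u i Du)) _.
  by rewrite ler_wpM2l // normr_dotp_sub.
have mean i : `|\int[P]_w' gamma i (dotp (h (Z i w')) u) (Y i w') -
    \int[P]_w' gamma i (dotp (h (Z i w')) v) (Y i w')| <= F1 * wdist dd u v.
  rewrite -RintegralB //; [|exact: intgamma|exact: intgamma].
  apply: normr_expect_le_ae; first by rewrite mulr_ge0 // wdist_ge0.
    have := integrableB measurableT (intgamma i Du) (intgamma i Dv).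
    by move=> /measurable_int/measurable_EFinP.
  by apply: filterS ae_good => w' gw'; exact: lip.
rewrite !SE -sumrB; apply: le_trans (ler_norm_sum _ _ _) _.
rewrite -mulrA mulr_natl -[X in _ <= _ *+ X]card_ord -sumr_const.
apply: ler_sum => i _.
rewrite (_ : _ - _ - _ = (gamma i (dotp (h (Z i w)) u) (Y i w) -
    gamma i (dotp (h (Z i w)) v) (Y i w)) -
    (\int[P]_w' gamma i (dotp (h (Z i w')) u) (Y i w') -
    \int[P]_w' gamma i (dotp (h (Z i w')) v) (Y i w'))); last by ring.
apply: le_trans (ler_normB _ _) _.
by rewrite -mulrA mulr_natl mulr2n lerD // lip.
Qed.

Let linear_lipschitz (c : 'I_p -> R) u v :
  `|\sum_j keff u j * c j - \sum_j keff v j * c j| <= max_abs c * wdist dd u v.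
Proof.
rewrite -sumrB mulr_sumr; apply: le_trans (ler_norm_sum _ _ _) _.
apply: ler_sum => j _.
rewrite (_ : _ - _ = dd j * (u 0 j - v 0 j) * c j); last by rewrite /keff; ring.
by rewrite normrM mulrC normrM (gtr0_norm (dd0 j)) ler_wpM2r ?le_max_abs // mulr_ge0 // ltW.
Qed.

(** By the decomposition, the remainder differs from S by a linear term. *)
Let W_lipschitz w u v : good w -> D0 u -> D0 v ->
  `|\sum_j keff u j * W j u w - \sum_j keff v j * W j v w| <=
  (N%:R * (2 * F1) + max_abs (T^~ w)) * wdist dd u v.
Proof.
move=> gw Du Dv.
have E z : D0 z -> \sum_j keff z j * W j z w =
    S z w - S theta w - \sum_j keff z j * T j w.
  move=> Dz; rewrite (decomposition gw Dz).
  under [X in _ = _ + X - _ - _]eq_bigr do rewrite mulrDr.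
  by rewrite big_split /=; ring.
rewrite !E // (_ : _ - _ - _ = (S u w - S v w) -
  (\sum_j keff u j * T j w - \sum_j keff v j * T j w)); last by ring.
apply: le_trans (ler_normB _ _) _.
by rewrite mulrDl lerD // ?S_lipschitz // linear_lipschitz.
Qed.

Let mx_ae : {ae P, forall w, max_sumsq (fun i => Z i : Omega -> TZ) h dd w = mx w}.
Proof.
apply: filterS ae_good => w gw; rewrite /max_sumsq /mx.
by apply: eq_bigr => j _; apply: eq_bigr => i _; rewrite ccE.
Qed.

Let measurable_max_sumsq :
  measurable_fun setT (max_sumsq (fun i => Z i : Omega -> TZ) h dd).
Proof.
apply: measurable_bigmax => j; apply: measurable_sum => i.
apply: measurable_funX; apply: measurable_funM; last exact: measurable_cst.
exact: (measurableT_comp (mh j) (measurable_funPT (Z i))).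
Qed.

Let expectation_max_sumsq :
  ('E_P[max_sumsq (fun i => Z i : Omega -> TZ) h dd] = Em%:E)%E.
Proof.
rewrite unlock EFin_expect //; apply: ae_eq_integral => //.
- exact/measurable_EFinP.
- by apply/measurable_EFinP; case: bmx.
- by apply: filterS mx_ae => w -> _.
Qed.

Let expectation_sqrt_max_sumsq :
  ('E_P[fun w => Num.sqrt (max_sumsq (fun i => Z i : Omega -> TZ) h dd w)] = Es%:E)%E.
Proof.
rewrite unlock EFin_expect; last exact: bmeas_sqrt.
apply: ae_eq_integral => //.
- apply/measurable_EFinP; apply: measurableT_comp measurable_max_sumsq.
  by apply: continuous_measurable_fun; exact: sqrt_continuous.
- by apply/measurable_EFinP; case: (bmeas_sqrt bmx).
- by apply: filterS mx_ae => w -> _.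
Qed.

Let diamR := diam dd D0.

Let wdist_diam v : D0 v -> ((wdist dd v theta)%:E <= diamR)%E.
Proof. by move=> Dv; apply: ereal_sup_ubound; exists v => //; exists theta. Qed.

Let A := A_const P (fun i => Z i : Omega -> TZ) h dd F2 diamR.
Let B := B_const P (fun i => Z i : Omega -> TZ) h dd F1 F2 diamR.
Let C := C_const F1 F2 diamR.

(** A finite set of parameters comes with its own radius r; monotonicity in r gives
    the stated threshold, whether or not the domain is bounded. *)
Let threshold_ge (r x : R) : let phr := Num.min (2 * F1) (F2 * r / 2) in
  0 <= r -> (r%:E <= diamR)%E -> 0 <= x ->
  ((2 * F2 * r * Num.sqrt (2 * ln (2 * p%:R)) * Es +
    phr * Num.sqrt Em * Num.sqrt (2 * x) + 2 * phr * x)%:E <=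
   A * (Num.sqrt (2 * ln (2 * p%:R)))%:E + B * (Num.sqrt (2 * x))%:E +
   C * x%:E)%E.
Proof.
move=> phr r0 rD x0.
have phr0 : 0 <= phr by rewrite le_min mulr_ge0 //= divr_ge0 // mulr_ge0.
have phrE : (phr%:E <= phi_const F1 F2 diamR)%E.
  rewrite /phi_const /phr EFin_min le_min2 //.
  by rewrite EFinM EFinM lee_wpmul2r ?lee_fin ?invr_ge0 // lee_wpmul2l // lee_fin.
rewrite !EFinD; apply: leeD; first apply: leeD.
- rewrite /A /A_const expectation_sqrt_max_sumsq.
  rewrite (_ : 2 * F2 * r * _ * Es = (2 * F2 * r * Es) * Num.sqrt (2 * ln (2 * p%:R))).
    rewrite EFinM lee_wpmul2r ?lee_fin ?sqrtr_ge0 // EFinM lee_wpmul2r ?lee_fin //.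
    apply: (@le_trans _ _ ((8 * psi_const F2)%:E * r%:E)%E).
      rewrite -EFinM lee_fin ler_wpM2r // /psi_const mulrCA -[X in _ <= X]mulrC.
      by rewrite ler_wpM2r //; lra.
    by rewrite lee_wpmul2l // lee_fin /psi_const mulr_ge0 // divr_ge0.
  by ring.
- rewrite /B /B_const expectation_max_sumsq /=.
  by rewrite EFinM lee_wpmul2r ?lee_fin ?sqrtr_ge0 // EFinM lee_wpmul2r ?lee_fin ?sqrtr_ge0.
- rewrite /C /C_const EFinM lee_wpmul2r ?lee_fin //.
  apply: (@le_trans _ _ (8%:E * phr%:E)%E).
    by rewrite -EFinM lee_fin ler_wpM2r // ler_nat.
  by rewrite lee_wpmul2l // lee_fin.
Qed.

(** Each of the 2 * p signed coordinates has a share q / (2 * p) of the probability. *)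
Let linear_tail q : 0 < q < 1 ->
  (P [set w | (F1 * Num.sqrt (2 * N%:R * ln (2 * p%:R / q)) <
    max_abs (T^~ w))%R] <= q%:E)%E.
Proof.
move=> /andP[q0 q1]; have p1 : 1 <= p%:R :> R by rewrite ler1n.
have p_gt0R : 0 < p%:R :> R by rewrite ltr0n.
set y := ln (2 * p%:R / q).
have pq1 : 1 < 2 * p%:R / q by rewrite ltr_pdivlMr // mul1r; lra.
have y0 : 0 < y by exact: ln_gt0.
have expy : expR (- y) = q / (2 * p%:R).
  by rewrite expRN lnK ?posrE ?divr_gt0 ?mulr_gt0 // invf_div.
set t := F1 * Num.sqrt (2 * N%:R * y).
pose Tb (jb : 'I_p * bool) w := (-1) ^+ jb.2 * T jb.1 w.
have mTb jb : measurable_fun setT (Tb jb) by case: (bmeasZ ((-1) ^+ jb.2) (bT jb.1)).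
have -> : q = #|{: 'I_p * bool}|%:R * expR (- y).
  rewrite card_prod card_ord card_bool expy natrM; field.
  by rewrite gt_eqF.
apply: (@union_bound _ _ _ _ _ (fun jb => [set w | t < Tb jb w])).
- by move=> jb; exact: measurable_superlevel.
- by apply: measurable_superlevel; have [] := bmeas_max_abs bT.
- move=> w /=; have [j ->] := max_abs_attained (Ordinal p_gt0) (T^~ w) => tT.
  case: (ger0P (T j w)) tT => _ tT.
    by exists (j, false) => //=; rewrite /Tb expr0 mul1r.
  by exists (j, true) => //=; rewrite /Tb expr1 mulN1r.
- move=> [j b']; pose x1b i u := (-1) ^+ b' * x1 i j u.
  have x1bF i u : `|x1b i u| <= F1.
    rewrite normrM normr_sign mul1r normrM -[leRHS]mul1r.
    by rewrite ler_pM // normr_clip_le.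
  have := @hoeffding_tail _ _ _ _ _ P N U mU indep x1b F1 y N_gt0 (ltW y0) F1_ge0
    (fun i => bmeasZ _ (bx1 i j)) x1bF.
  congr (P _ <= _)%E; apply/seteqP; split => w /=; rewrite /t /Tb /T /=;
    rewrite mulr_sumr; congr (_ < _); apply: eq_bigr => i _;
    by rewrite expectZ ?mulrBr //; exact: bU.
Qed.

(** Along a sequence in the domain, the first m terms form a finite set, and the
    coordinates j share q equally. *)
Let remainder_tail (s : nat -> 'rV[R]_p) (Ds : forall n, D0 (s n)) m (q c e : R) :
  0 < q < 1 -> 0 < e ->
  (A * (Num.sqrt (2 * ln (2 * p%:R)))%:E + B * (Num.sqrt (2 * ln (p%:R / q)))%:E +
     C * (ln (p%:R / q))%:E <= c%:E)%E ->
  (P (\bigcup_(n in `I_m) [set w | (c + e < max_abs (fun j => W j (s n) w))%R])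
     <= q%:E)%E.
Proof.
move=> /andP[q0 q1] e0; set x := ln (p%:R / q) => thc.
have p1 : 1 <= p%:R :> R by rewrite ler1n.
have p_gt0R : 0 < p%:R :> R by rewrite ltr0n.
have pq1 : 1 < p%:R / q by rewrite ltr_pdivlMr // mul1r (lt_le_trans q1).
have x0 : 0 < x by exact: ln_gt0.
have expx : expR (- x) = q / p%:R.
  by rewrite expRN lnK ?posrE ?divr_gt0 // invf_div.
(* theta is put in front, as the base point of the contraction argument *)
pose vs (k : 'I_m.+1) := if k == ord0 then theta else s k.-1.
have vs0 : vs ord0 = theta by rewrite /vs eqxx.
have Dvs k : D0 (vs k) by rewrite /vs; case: ifP.
pose r := \big[Order.max/0]_k wdist dd (vs k) theta.
have r0 : 0 <= r by exact: bigmax_ge_id.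
have vsr k : wdist dd (vs k) theta <= r.
  exact: (le_bigmax _ (fun k => wdist dd (vs k) theta)).
have rD : (r%:E <= diamR)%E.
  rewrite /r; elim/big_ind: _ => [|y z hy hz|k _]; last exact: wdist_diam.
    by apply: le_trans (wdist_diam D0theta); rewrite lee_fin wdist_ge0.
  by rewrite EFin_max ge_max hy hz.
have := le_trans (threshold_ge r0 rD (ltW x0)) thc; rewrite lee_fin => th_r.
have -> : q = #|'I_p|%:R * (q / p%:R).
  by rewrite card_ord mulrCA mulfV ?mulr1 // gt_eqF.
have mW (j : 'I_p) : measurable_fun setT (fun w => max_abs (fun k => W j (vs k) w)).
  by have [] := bmeas_max_abs (fun k => bW j (vs k)).
apply: (@union_bound _ _ _ _ _
  (fun j => [set w | c + e < max_abs (fun k => W j (vs k) w)])).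
- by move=> j; exact: measurable_superlevel.
- apply: bigcup_measurable => n _; apply: measurable_superlevel.
  by have [] := bmeas_max_abs (fun j => bW j (s n)).
- move=> w [n /= nm].
  have [j ->] := max_abs_attained (Ordinal p_gt0) (fun j => W j (s n) w) => cW.
  exists j => //=; apply: lt_le_trans cW _.
  exact: (le_max_abs (fun k => W j (vs k) w) (lift ord0 (Ordinal nm))).
- move=> j; rewrite -expx.
  apply: le_trans (@finite_tail j m vs r x e vs0 Dvs vsr x0 e0).
  apply: le_measure; rewrite ?inE; try exact: measurable_superlevel.
  by move=> w /=; apply: le_lt_trans; rewrite lerD2r.
Qed.

(** The remainder process is set to 0 on a null event, off which it is a Lipschitz
    function of v divided by the distance to theta; this makes its supremum over
    the domain measurable. *)
Lemma linearization : exists xi1 xi : 'rV[R]_p -> {RV P >-> R},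
    [/\ {ae P, forall w, forall v, D0 v ->
          S v w = S theta w + (xi1 v w + xi v w) * wdist dd v theta},
        measurable_fun setT (sup_abs D0 xi) /\
        (forall q : R, (0 < q < 1)%R ->
          P [set w | A * (Num.sqrt (2 * ln (2 * p%:R)))%:E
                     + B * (Num.sqrt (2 * ln (p%:R / q)))%:E
                     + C * (ln (p%:R / q))%:E < sup_abs D0 xi w]
          <= q%:E)%E &
        measurable_fun setT (sup_abs D0 xi1) /\
        (forall q : R, (0 < q < 1)%R ->
          P [set w | (F1 * Num.sqrt (2 * N%:R * ln (2 * p%:R / q)))%:E
                     < sup_abs D0 xi1 w]
          <= q%:E)%E].
Proof.
have [Bad [mBad PBad0 subBad]] := ae_good.
have goodW w : ~ Bad w -> good w.
  by move=> nB; apply: contrapT => ng; apply: nB; exact: subBad.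
have p1 : 1 <= p%:R :> R by rewrite ler1n.
have p_gt0R : 0 < p%:R :> R by rewrite ltr0n.
pose K w v := \1_(~` Bad) w * \sum_j keff v j * W j v w.
pose K1 w v := \sum_j keff v j * T j w.
have ind0 w : (0 : R) <= \1_(~` Bad) w by rewrite indicE ler0n.
have ind1 w : \1_(~` Bad) w <= (1 : R) by rewrite indicE lern1 leq_b1.
have mK v : measurable_fun setT (fun w => K w v / wdist dd v theta).
  apply: measurable_funM; last exact: measurable_cst.
  apply: measurable_funM; first by apply: measurable_indic; exact: measurableC.
  by apply: measurable_sum => j; case: (bmeasZ (keff v j) (bW j v)).
have mK1 v : measurable_fun setT (fun w => K1 w v / wdist dd v theta).
  apply: measurable_funM; last exact: measurable_cst.
  by apply: measurable_sum => j; case: (bmeasZ (keff v j) (bT j)).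
pose xi v : {RV P >-> R} := HB.pack (fun w => K w v / wdist dd v theta)
  (isMeasurableFun.Build _ _ _ _ _ (mK v)).
pose xi1 v : {RV P >-> R} := HB.pack (fun w => K1 w v / wdist dd v theta)
  (isMeasurableFun.Build _ _ _ _ _ (mK1 v)).
have keff_theta j : keff theta j = 0 by rewrite /keff subrr mulr0.
have [s [Ds s_dense]] := dense_sequence dd0 D0theta.
have supK w : sup_abs D0 xi w =
    ereal_sup (range (fun n => `|xi (s n) w|%:E)).
  apply: (@ereal_sup_ratio_dense _ _ _ dd0 D0 theta s (K w)
    (N%:R * (2 * F1) + max_abs (T^~ w))) => //.
  - by rewrite addr_ge0 ?max_abs_ge0 // !mulr_ge0.
  - by rewrite /K big1 ?mulr0 // => j _; rewrite keff_theta mul0r.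
  - move=> u v Du Dv; rewrite /K; have [Bw|/goodW gw] := pselect (Bad w).
      rewrite indicE memNset /=; last by apply.
      rewrite !mul0r subrr normr0 mulr_ge0 ?wdist_ge0 //.
      by rewrite addr_ge0 ?max_abs_ge0 // !mulr_ge0.
    rewrite -mulrBr normrM (ger0_norm (ind0 w)).
    apply: le_trans (W_lipschitz gw Du Dv).
    by rewrite ler_piMl.
have supK1 w : sup_abs D0 xi1 w =
    ereal_sup (range (fun n => `|xi1 (s n) w|%:E)).
  apply: (@ereal_sup_ratio_dense _ _ _ dd0 D0 theta s (K1 w) (max_abs (T^~ w))) => //.
  - exact: max_abs_ge0.
  - by rewrite /K1 big1 // => j _; rewrite keff_theta mul0r.
  - by move=> u v Du Dv; exact: linear_lipschitz.
have msup : measurable_fun setT (sup_abs D0 xi).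
  rewrite (_ : sup_abs D0 xi = fun w => ereal_sup (range (fun n => `|xi (s n) w|%:E))).
    by apply: measurable_ereal_sup_seq => n; exact: measurableT_comp (mK (s n)).
  by apply/funext => w; exact: supK.
have msup1 : measurable_fun setT (sup_abs D0 xi1).
  rewrite (_ : sup_abs D0 xi1 = fun w => ereal_sup (range (fun n => `|xi1 (s n) w|%:E))).
    by apply: measurable_ereal_sup_seq => n; exact: measurableT_comp (mK1 (s n)).
  by apply/funext => w; exact: supK1.
exists xi1, xi; split.
- exists Bad; split => // w /= nS; apply: contrapT => nB; apply: nS => v Dv.
  have gw := goodW w nB.
  rewrite (decomposition gw Dv); congr (_ + _).
  rewrite /xi1 /xi /= /K1 /K indicE mem_set // mul1r -mulrDl -big_split /=.
  have [w0|w0] := eqVneq (wdist dd v theta) 0; last first.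
    by rewrite divfK //; apply: eq_bigr => j _; rewrite mulrDr.
  rewrite w0 mulr0 big1 // => j _.
  have /eqP : \sum_j `|keff v j| = 0 by rewrite sum_keff.
  rewrite psumr_eq0 // => /allP/(_ j (mem_index_enum j))/=.
  by rewrite normr_eq0 => /eqP ->; rewrite mul0r.
- split => // q /andP[q0 q1].
  set th := (A * _ + B * _ + C * _)%E.
  case thE : th => [c||]; last 2 first.
  - by rewrite [X in P X](_ : _ = set0) ?measure0 ?lee_fin ?ltW //;
      apply/seteqP; split => // w /=; rewrite ltNge leey.
  - have D00 : (0%:E <= diamR)%E.
      by apply: le_trans (wdist_diam D0theta); rewrite lee_fin wdist_ge0.
    have x0 : 0 <= ln (p%:R / q).
      by apply/ltW/ln_gt0; rewrite ltr_pdivlMr // mul1r (lt_le_trans q1).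
    by have := threshold_ge (lexx 0) D00 x0; rewrite -/th thE leeNy_eq.
  under eq_set do rewrite supK.
  apply: (@tail_ereal_sup_seq _ _ _ P (fun n w => `|xi (s n) w|)) => [n|m e e0].
    exact: measurableT_comp (mK (s n)).
  have thc : (th <= c%:E)%E by rewrite thE.
  have q01 : 0 < q < 1 by rewrite q0.
  apply: le_trans (remainder_tail Ds m q01 e0 thc); apply: le_measure; rewrite ?inE.
  + apply: bigcup_measurable => n _; apply: measurable_superlevel.
    exact: measurableT_comp (mK (s n)).
  + apply: bigcup_measurable => n _; apply: measurable_superlevel.
    by have [] := bmeas_max_abs (fun j => bW j (s n)).
  + move=> w [n nm /= cxi]; exists n => //=; apply: lt_le_trans cxi _.
    rewrite /xi /= /K -mulrA normrM (ger0_norm (ind0 w)).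
    apply: le_trans (keff_ratio_le (s n) (fun j => W j (s n) w)).
    by rewrite ler_piMl.
- split => // q q01.
  apply: le_trans (linear_tail q01); apply: le_measure; rewrite ?inE.
  + rewrite -[X in measurable X]setTI; exact: emeasurable_fun_o_infty.
  + apply: measurable_superlevel; have [] := bmeas_max_abs bT; exact.
  + move=> w /= tsup.
    have sup_le : (sup_abs D0 xi1 w <= (max_abs (T^~ w))%:E)%E.
      by apply: ge_ereal_sup => _ [v Dv <-]; rewrite lee_fin; exact: keff_ratio_le.
    by have := lt_le_trans tsup sup_le; rewrite lte_fin.
Qed.

End setting.

Theorem corollary2p2 (d dY dZ : measure_display) (Omega : measurableType d)
    (TY : measurableType dY) (TZ : measurableType dZ) (R : realType)
    (P : probability Omega R) (N p : nat)
    (Y : 'I_N -> {RV P >-> TY}) (Z : 'I_N -> {RV P >-> TZ})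
    (gamma : 'I_N -> R -> TY -> R) (h : TZ -> 'rV[R]_p) (D0 : set 'rV[R]_p)
    (a b : 'I_N -> \bar R) (F1 F2 : R) (dd : 'I_p -> R)
    (N_gt0 : (0 < N)%N) (p_gt0 : (0 < p)%N)
    (indep : mutually_independent P (fun i w => (Y i w, Z i w)))
    (mgamma : forall i, measurable_fun setT (fun ty : R * TY => gamma i ty.1 ty.2))
    (mh : forall j : 'I_p, measurable_fun setT (fun z => h z 0 j))
    (intgamma : forall i v, D0 v ->
      P.-integrable setT (EFin \o (fun w => gamma i (dotp (h (Z i w)) v) (Y i w))))
    (hreg : regularity P Y gamma a b F1 F2)
    (hbnd : boundedness P Z h dd)
    (hdom : parameter_domain P Z h D0 a b)
    (theta : 'rV[R]_p) (D0theta : D0 theta) :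
  let S := fun (v : 'rV[R]_p) (w : Omega) => \sum_(i < N)
    centered P (fun w' => gamma i (dotp (h (Z i w')) v) (Y i w')) w in
  let diamR := diam dd D0 in
  let A := A_const P Z h dd F2 diamR in
  let B := B_const P Z h dd F1 F2 diamR in
  let C := C_const F1 F2 diamR in
  exists xi1 xi : 'rV[R]_p -> {RV P >-> R},
    [/\ {ae P, forall w, forall v, D0 v ->
          S v w = S theta w + (xi1 v w + xi v w) * wdist dd v theta},
        measurable_fun setT (sup_abs D0 xi) /\
        (forall q : R, (0 < q < 1)%R ->
          P [set w | A * (Num.sqrt (2 * ln (2 * p%:R)))%:E
                     + B * (Num.sqrt (2 * ln (p%:R / q)))%:E
                     + C * (ln (p%:R / q))%:E < sup_abs D0 xi w]
          <= q%:E)%E &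
        measurable_fun setT (sup_abs D0 xi1) /\
        (forall q : R, (0 < q < 1)%R ->
          P [set w | (F1 * Num.sqrt (2 * N%:R * ln (2 * p%:R / q)))%:E
                     < sup_abs D0 xi1 w]
          <= q%:E)%E].
Proof.
exact: (linearization N_gt0 p_gt0 indep mgamma mh intgamma hreg hbnd hdom D0theta).
Qed.
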